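(* Let $N=2$ and consider the system $$\dot{\boldsymbol{a}}_j-\lambda d_j\mathbb{J}\dot{\boldsymbol{a}}_j=-\frac1\pi\nabla_{\boldsymbol{a}_j}W(\boldsymbol{a};\boldsymbol{q}(\boldsymbol{a})),\qquad \boldsymbol{a}_j(0)=\boldsymbol{a}_j^0,\qquad 1\le j\le4.$$ If the initial data $\boldsymbol a^0=(\boldsymbol a_1^0,\dots,\boldsymbol a_4^0)\in(\mathbb{T}^2)^4_*$ satisfies $$\boldsymbol a_1^0=(0.5,0.5)^T+(\alpha^0,\beta^0)^T,\quad \boldsymbol a_2^0=(0.5,0.5)^T+(-\alpha^0,-\beta^0)^T,$$ $$\boldsymbol a_3^0=(0.5,0.5)^T+(-\alpha^0,\beta^0)^T,\quad \boldsymbol a_4^0=(0.5,0.5)^T+(\alpha^0,-\beta^0)^T,$$ then the solution $\boldsymbol a=\boldsymbol a(t)=(\boldsymbol a_1(t),\boldsymbol a_2(t),\boldsymbol a_3(t),\boldsymbol a_4(t))$ is of the form $$\boldsymbol a_1(t)=(0.5,0.5)^T+(\alpha(t),\beta(t))^T,\quad \boldsymbol a_2(t)=(0.5,0.5)^T+(-\alpha(t),-\beta(t))^T,$$ $$\boldsymbol a_3(t)=(0.5,0.5)^T+(-\alpha(t),\beta(t))^T,\quad \boldsymbol a_4(t)=(0.5,0.5)^T+(\alpha(t),-\beta(t))^T,$$ where $\alpha,\beta$ satisfy $$\begin{pmatrix}\dot\alpha\\ \dot\beta\end{pmatrix}=\frac{2}{1+\lambda^2}\begin{pmatrix}1&\lambda\\-\lambda&1\end{pmatrix}\begin{pmatrix}\partial_xF(2\alpha,2\beta)-\partial_xF(2\alpha,0)\\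 \partial_yF(2\alpha,2\beta)-\partial_yF(0,2\beta)\end{pmatrix}.$$
   Context: $\mathbb{T}^2=(\mathbb{R}/\mathbb{Z})^2$ is the unit torus; $\lambda\in\mathbb{R}$; $(\mathbb{T}^2)^{4}_*$ is the set of $4$-tuples of pairwise distinct points of $\mathbb{T}^2$; $d_1=d_2=1$, $d_3=d_4=-1$; $\mathbb{J}=\begin{pmatrix}0&1\\-1&0\end{pmatrix}$. $F$ solves $\Delta F=2\pi(\delta-1)$ on $\mathbb{T}^2$ (with $\delta$ the Dirac mass at $\boldsymbol 0$) and $\int_{\mathbb{T}^2}F\,d\boldsymbol x=0$. For $\boldsymbol a\in(\mathbb{T}^2)^4_*$ and $\boldsymbol q\in2\pi\sum_{j=1}^4d_j\boldsymbol a_j+2\pi\mathbb{Z}^2$, the renormalized energy is $$W(\boldsymbol a;\boldsymbol q)=-\pi\sum_{1\le j\ne k\le4}d_jd_kF(\boldsymbol a_j-\boldsymbol a_k)+\tfrac12|\boldsymbol q|^2.$$ In the system, $t\mapsto\boldsymbol q(\boldsymbol a(t))\in\mathbb{R}^2$ is the unique continuous map with $\boldsymbol q(\boldsymbol a(0))=\boldsymbol q_0$ and $\boldsymbol q(\boldsymbol a(t))\in2\pi\sum_{j}d_j\boldsymbol a_j(t)+2\pi\mathbb{Z}^2$, for a given $\boldsymbol q_0\in2\pi\sum_{j}d_j\boldsymbol a_j^0+2\pi\mathbb{Z}^2$. In the gradient the dependence of $\boldsymbol q$ on $\boldsymbol a$ is included (locally $\boldsymbol q=2\pi\sum_kd_k\boldsymbol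 a_k+2\pi\boldsymbol k$ with constant $\boldsymbol k\in\mathbb{Z}^2$), so $$\nabla_{\boldsymbol a_j}W(\boldsymbol a;\boldsymbol q)=2\pi d_j\Bigl(-\sum_{k\ne j}d_k\nabla F(\boldsymbol a_j-\boldsymbol a_k)+\boldsymbol q\Bigr).$$
   Formalization: The formal theorem assumes q_0 = 0; for any other admissible q_0 in 2πZ² the claim fails, since the symmetric form makes a_1+a_2 constant and adding the equations for j=1,2 gives 0 = -4q(a(t)) with q(a(t)) = q_0. *)

(* Defs.v *)
From mathcomp Require Import all_boot all_order all_algebra.
From mathcomp Require Import all_classical all_reals all_analysis.

Set Implicit Arguments.
Unset Strict Implicit.
Unset Printing Implicit Defensive.
Import Order.TTheory GRing.Theory Num.Theory.
Import numFieldNormedType.Exports.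
Local Open Scope classical_set_scope.
Local Open Scope ring_scope.

(* A point of T^2 = (R/Z)^2 is represented by a point of R^2 up to [eqT2], a
   function on T^2 by a Z^2-periodic function on R^2, and a path in T^2 by a
   lift to R^2 (lifts exist for continuous paths). *)
Definition lattice {R : realType} : set (R * R) :=
  [set x | exists m n : int, x = (m%:~R, n%:~R)].

Definition eqT2 {R : realType} (x y : R * R) : Prop := lattice (x - y).

Definition periodic2 {R : realType} (f : R * R -> R) : Prop :=
  forall x y, eqT2 x y -> f x = f y.

Definition pdx {R : realType} (f : R * R -> R) (x : R * R) : R :=
  'D_((1 : R), (0 : R)) f x.

Definition pdy {R : realType} (f : R * R -> R) (x : R * R) : R :=
  'D_((0 : R), (1 : R)) f x.

Definition grad {R : realType} (f : R * R -> R) (x : R * R) : R * R :=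
  (pdx f x, pdy f x).

Definition laplacian {R : realType} (f : R * R -> R) (x : R * R) : R :=
  pdx (pdx f) x + pdy (pdy f) x.

(* Meant for open U. *)
Fixpoint Ck {R : realType} (k : nat) (U : set (R * R)) (f : R * R -> R) : Prop :=
  (forall x, U x -> {for x, continuous f}) /\
  if k is k'.+1 then
    [/\ forall x, U x -> derivable f x ((1 : R), (0 : R)),
        forall x, U x -> derivable f x ((0 : R), (1 : R)),
        Ck k' U (pdx f) & Ck k' U (pdy f)]
  else True.

Definition smooth_on {R : realType} (U : set (R * R)) (f : R * R -> R) : Prop :=
  forall k, Ck k U f.

Definition lebesgue2 {R : realType} :=
  (@lebesgue_measure R \x @lebesgue_measure R)%E.

Definition unit_square {R : realType} : set (R * R) :=
  `[0 : R, 1] `*` `[0 : R, 1].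

Definition intT2 {R : realType} (f : R * R -> R) : R :=
  (\int[lebesgue2]_(x in unit_square) f x)%R.

(* The last clause is Delta F = 2 pi (delta_0 - 1) in the sense of
   distributions on T^2.  This determines F almost everywhere; smoothness off
   the lattice selects the representative whose pointwise gradient is meant.
   The values of F on the lattice play no role. *)
Definition green_function {R : realType} (F : R * R -> R) : Prop :=
  [/\ periodic2 F,
      smooth_on (~` lattice) F,
      lebesgue2.-integrable unit_square (EFin \o F),
      intT2 F = 0 &
      forall phi : R * R -> R, periodic2 phi -> smooth_on setT phi ->
        intT2 (fun x => F x * laplacian phi x)
        = 2 * pi * (phi 0 - intT2 phi)].

Definition degree {R : realType} (j : 'I_4) : R := if (j < 2)%N then 1 else -1.

Definition dipole {R : realType} (a : 'I_4 -> R * R) : R * R :=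
  (2 * pi) *: \sum_(j < 4) degree j *: a j.

Definition distinctT2 {R : realType} (a : 'I_4 -> R * R) : Prop :=
  forall j k, j != k -> ~ eqT2 (a j) (a k).

Definition momentum_class {R : realType} (a : 'I_4 -> R * R) : set (R * R) :=
  [set q | exists2 k, lattice k & q = dipole a + (2 * pi) *: k].

Definition renormalized_energy {R : realType} (F : R * R -> R)
    (a : 'I_4 -> R * R) (q : R * R) : R :=
  - pi * (\sum_(j < 4) \sum_(k < 4 | j != k)
            degree j * degree k * F (a j - a k))
  + (q.1 ^+ 2 + q.2 ^+ 2) / 2.

Definition update {R : realType} (a : 'I_4 -> R * R) (j : 'I_4) (x : R * R) :
  'I_4 -> R * R := fun k => if k == j then x else a k.

(* The gradient in a_j of a |-> W (a; q(a)), where q(b) stands for the local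
   continuous branch through q at a: q(b) = q + 2 pi sum_k d_k (b_k - a_k). *)
Definition grad_energy {R : realType} (F : R * R -> R)
    (a : 'I_4 -> R * R) (q : R * R) (j : 'I_4) : R * R :=
  grad (fun x => let b := update a j x in
                 renormalized_energy F b (q + (dipole b - dipole a))) (a j).

Definition Jmul {R : realType} (v : R * R) : R * R := (v.2, - v.1).

Definition time_interval {R : realType} (T : \bar R) : set R :=
  [set t | 0 <= t /\ (t%:E < T)%E].

(* f has derivative v at t relative to I (one-sided at an end point of I). *)
Definition derivative_on {R : realType} (I : set R) (f : R -> R * R) (t : R)
    (v : R * R) : Prop :=
  (fun s => (s - t)^-1 *: (f s - f t)) @ within I t^' --> v.

(* a is a lift to R^2 of the path in (T^2)^4_*, and q is t |-> q(a(t)). *)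
Definition vortex_solution {R : realType} (F : R * R -> R) (lambda : R)
    (T : \bar R) (a0 : 'I_4 -> R * R) (q0 : R * R)
    (a : R -> 'I_4 -> R * R) (q : R -> R * R) : Prop :=
  [/\ forall j, eqT2 (a 0 j) (a0 j),
      q 0 = q0,
      {within time_interval T, continuous q} &
      forall t, time_interval T t ->
        [/\ distinctT2 (a t),
            momentum_class (a t) (q t) &
            forall j, exists2 v, derivative_on (time_interval T) (a^~ j) t v &
              v - (lambda * degree j) *: Jmul v
              = - pi^-1 *: grad_energy F (a t) (q t) j]].

Definition symmetric_configuration {R : realType} (alpha beta : R) (j : 'I_4) :
    R * R :=
  (2^-1, 2^-1) + nth 0 [:: (alpha, beta); (- alpha, - beta);
                           (- alpha, beta); (alpha, - beta)] j.

Definition reduced_field {R : realType} (F : R * R -> R) (lambda : R)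
    (alpha beta : R) : R * R :=
  let u := pdx F (2 * alpha, 2 * beta) - pdx F (2 * alpha, 0) in
  let v := pdy F (2 * alpha, 2 * beta) - pdy F (0, 2 * beta) in
  (2 / (1 + lambda ^+ 2)) *: (u + lambda * v, - lambda * u + v).

(* Main.v *)
Require Import Defs.
From mathcomp Require Import all_boot all_order all_algebra.
From mathcomp Require Import all_classical all_reals all_analysis.
From mathcomp Require Import measurable_realfun.
From mathcomp Require Import ring lra zify.

Set Implicit Arguments.
Unset Strict Implicit.
Unset Printing Implicit Defensive.
Import Order.TTheory GRing.Theory Num.Theory.
Import numFieldNormedType.Exports.
Local Open Scope classical_set_scope.
Local Open Scope ring_scope.

(** The four vortices are mapped to one another, with their degrees reversed,
    by the reflection of either coordinate about 1/2.  The initial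
    configuration is fixed by both reflections, the system is equivariant
    under them and its solutions are unique, so the solution stays fixed by
    both; a configuration fixed by both is of the required form, and on it
    the equation for the first vortex is the reduced system.

    Equivariance needs F to be even in each coordinate, which has to be
    extracted from the distributional equation.  Let s be a reflection and
    g = F - F o s.  Testing the equation against the plane waves
    cos (2 pi (m x + n y) + th), which are eigenfunctions of the Laplacian,
    shows that g is orthogonal to all of them: the right-hand side of the
    equation does not change when the test function is reflected, because
    Lebesgue measure on the unit square does not.  An integrable function
    that is orthogonal to all plane waves vanishes where it is continuous.
    Indeed, if it were positive at z, it could be paired with large powers of
    a suitable multiple of the trigonometric polynomial
    (1 + cos (2 pi (x - z1))) (1 + cos (2 pi (y - z2))), which peaks at z and
    its translates; the pairing would tend to infinity
    ([wave_orthogonal_le0]).  Hence [green_reflect2], and with it the value of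
    the gradient of the energy ([grad_energyE]) and the equivariance of the
    velocity field ([vortex_field_mirror]).

    The vector q (a (t)) minus its value predicted by a (t) lies in a lattice
    and is continuous, hence constant ([momentum_constant]); for the given
    data this makes q the dipole moment of the configuration recentred at
    (1/2, 1/2), so the system becomes autonomous: a' = [vortex_field] a.

    Uniqueness is used only between a solution and its mirror image.  Off the
    lattice F is of class C^2, so the field is locally Lipschitz, and the
    differences between the coordinates of the two solutions satisfy a linear
    differential inequality near any time at which they all vanish.
    Gronwall's inequality ([gronwall_family]) propagates their vanishing to
    the right of such a time, and a supremum argument to the whole interval
    ([zero_continuation], [mirror_invariant]). *)

(** * Directional derivatives along lines *)

(** A directional derivative only sees the restriction to a line.  This gives
    the chain rule for an affine inner map without total differentiability
    of f. *)
Lemma is_derive_comp_affine (R : realType) (V V' W : normedModType R)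
    (f : V' -> W) (g : V -> V') (x v : V) (w : V') (df : W) :
  (forall h : R, g (h *: v + x) = h *: w + g x) ->
  is_derive (g x) w f df -> is_derive x v (f \o g) df.
Proof.
move=> gE [fd fv].
have E : (fun h : R => h^-1 *: (((f \o g) \o shift x) (h *: v) - (f \o g) x)) =
         (fun h : R => h^-1 *: ((f \o shift (g x)) (h *: w) - f (g x))).
  by apply/funext => h /=; rewrite gE.
by split; [rewrite /derivable E|rewrite /derive E].
Qed.

Lemma is_derive_line (R : realType) (V W : normedModType R) (f : V -> W)
    (x v : V) (df : W) :
  is_derive x v f df <-> is_derive (0 : R) 1 (fun h : R => f (h *: v + x)) df.
Proof.
have E : (fun h : R => h^-1 *: (((fun k : R => f (k *: v + x)) \o shift (0 : R))
           (h *: (1 : R)) - f ((0 : R) *: v + x))) =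
         (fun h : R => h^-1 *: ((f \o shift x) (h *: v) - f x)).
  by apply/funext => h /=; rewrite addr0 scale0r add0r [h%:A]mulr1.
split=> -[D1 D2].
  by split; [rewrite /derivable E|rewrite /derive E].
by split; [move: D1; rewrite /derivable E|move: D2; rewrite /derive E].
Qed.

Lemma is_derive_scale (R : realType) (V : normedModType R) (f : V -> R)
    (x v : V) (k df : R) :
  is_derive x v f df -> is_derive x (k *: v) f (k * df).
Proof.
move=> /is_derive_line H; apply/is_derive_line.
rewrite (_ : (fun h : R => _) = (fun h : R => f (h *: v + x)) \o (fun h : R => k * h)).
  have dk : is_derive (0 : R) 1 (fun h : R => k * h) k.
    have := @is_deriveZ _ _ _ (@id R) k 0 1 1 (is_derive_id _ _).
    by rewrite [k *: 1]mulr1.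
  have H' : is_derive (k * 0 : R) 1 (fun h : R => f (h *: v + x)) df by rewrite mulr0.
  by rewrite mulrC; exact: (is_derive1_comp H' dk).
by apply/funext => h /=; rewrite scalerA mulrC.
Qed.

(** * Plane waves on the torus *)

Definition wave (R : realType) (m n : int) (th : R) (x : R * R) : R :=
  cos (2 * pi * (m%:~R * x.1 + n%:~R * x.2) + th).

(** The phase th makes the family stable under differentiation: a derivative
    multiplies the wave by a constant and advances th by pi / 2. *)
Lemma is_derive_wave (R : realType) (c : R) m n (th : R) (x v : R * R) :
  is_derive x v (fun y => c * wave m n th y)
    (c * (2 * pi * (m%:~R * v.1 + n%:~R * v.2)) * wave m n (th + pi / 2) x).
Proof.
pose k := 2 * pi * (m%:~R * v.1 + n%:~R * v.2).
pose A := fun y : R * R => 2 * pi * (m%:~R * y.1 + n%:~R * y.2) + th.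
apply: (@is_derive_comp_affine R (R * R)%type R R (fun u : R => c * cos u) A x v k).
  by move=> h; rewrite /A /k /= /GRing.scale /=; ring.
have dcos : is_derive (A x) (k *: 1) (@cos R) (k * - sin (A x)).
  exact: is_derive_scale.
rewrite [k *: 1]mulr1 in dcos.
apply: is_derive_eq (is_deriveZ c dcos) _.
rewrite /GRing.scale /=.
by rewrite /wave addrA cosDpihalf /k /A; ring.
Qed.

Lemma continuous_wave (R : realType) m n (th : R) : continuous (wave m n th).
Proof.
move=> x; apply: continuous_comp; last exact: continuous_cos.
apply: cvgD; last exact: cvg_cst.
apply: cvgM; first exact: cvg_cst.
by apply: cvgD; apply: cvgM; (try exact: cvg_cst); [exact: cvg_fst|exact: cvg_snd].
Qed.

Lemma pdx_wave (R : realType) (c : R) m n (th : R) :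
  pdx (fun y => c * wave m n th y) =
  (fun y => c * (2 * pi * m%:~R) * wave m n (th + pi / 2) y).
Proof.
apply/funext => x; rewrite /pdx.
have := is_derive_wave c m n th x (1, 0) => H; rewrite derive_val /=.
by rewrite mulr1 mulr0 addr0.
Qed.

Lemma pdy_wave (R : realType) (c : R) m n (th : R) :
  pdy (fun y => c * wave m n th y) =
  (fun y => c * (2 * pi * n%:~R) * wave m n (th + pi / 2) y).
Proof.
apply/funext => x; rewrite /pdy.
have := is_derive_wave c m n th x (0, 1) => H; rewrite derive_val /=.
by rewrite mulr1 mulr0 add0r.
Qed.

Lemma smooth_wave (R : realType) (c : R) m n (th : R) :
  smooth_on setT (fun y => c * wave m n th y).
Proof.
have cw (c' : R) th' : continuous (fun y => c' * wave m n th' y).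
  by move=> x; apply: cvgM; [exact: cvg_cst|exact: continuous_wave].
move=> k; elim: k c th => [|k IH] c th /=; split => //; try by move=> ? _; exact: cw.
split => [x _|x _||].
- exact: (@ex_derive _ _ _ _ _ _ _ (is_derive_wave c m n th x (1, 0))).
- exact: (@ex_derive _ _ _ _ _ _ _ (is_derive_wave c m n th x (0, 1))).
- by rewrite pdx_wave.
- by rewrite pdy_wave.
Qed.

Lemma laplacian_wave (R : realType) (c : R) m n (th : R) x :
  laplacian (fun y => c * wave m n th y) x =
  - c * (2 * pi) ^+ 2 * (m%:~R ^+ 2 + n%:~R ^+ 2) * wave m n th x.
Proof.
rewrite /laplacian !(pdx_wave, pdy_wave).
rewrite (_ : wave m n (th + pi / 2 + pi / 2) x = - wave m n th x); first ring.
by rewrite /wave -[th + _ + _]addrA -splitr addrA cosDpi.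
Qed.

Lemma cosD_int2pi (R : realType) (u : R) (k : int) :
  cos (u + 2 * pi * k%:~R) = cos u.
Proof.
have H (n : nat) v : cos (v + 2 * pi * n%:R) = cos v :> R.
  elim: n v => [|n IH] v; first by rewrite mulr0 addr0.
  rewrite -[n.+1%:R]natr1 (_ : v + _ = v + 2 * pi * n%:R + pi *+ 2); last ring.
  by rewrite cosD2pi IH.
case: k => n; first exact: H.
by rewrite -(H n.+1); congr cos; rewrite NegzE mulrNz; ring.
Qed.

Lemma periodic_wave (R : realType) m n (th : R) : periodic2 (wave m n th).
Proof.
move=> x y [k [l /esym E]]; rewrite /wave.
have /= [E1 E2] : (k%:~R = x.1 - y.1) /\ (l%:~R = x.2 - y.2).
  by case: x y E => [x1 x2] [y1 y2] /= [-> ->].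
rewrite -[RHS](@cosD_int2pi R _ (m * k + n * l)); congr cos.
rewrite rmorphD /= !rmorphM /= E1 E2; ring.
Qed.

(** * Reflections of the unit square preserve the integral *)

(** The measurable structure that carries the Lebesgue measure of the plane. *)
Notation plane R := (measurableTypeR R * measurableTypeR R)%type.

(** For s = 1 the identity and for s = - 1 the reflection u |-> 1 - u.  One
    formula for both signs treats the reflections of either coordinate, and
    of both, at once. *)
Definition reflect_unit (R : realType) (s : R) (u : R) : R := s * u + (1 - s) / 2.

Lemma reflect_unit1 (R : realType) (u : R) : reflect_unit 1 u = u.
Proof. by rewrite /reflect_unit subrr mul0r addr0 mul1r. Qed.

Lemma reflect_unitN1 (R : realType) (u : R) : reflect_unit (-1) u = 1 - u.
Proof. by rewrite /reflect_unit; field. Qed.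

Lemma sqr1_cases (R : realType) (s : R) : s ^+ 2 = 1 -> s = 1 \/ s = -1.
Proof. by move=> /eqP; rewrite sqrf_eq1 => /orP[] /eqP ->; [left|right]. Qed.

Lemma measurable_reflect_unit (R : realType) (s : R) :
  measurable_fun setT (reflect_unit s : measurableTypeR R -> measurableTypeR R).
Proof.
apply: continuous_measurable_fun => x.
by apply: cvgD; [apply: cvgM => //; exact: cvg_cst|exact: cvg_cst].
Qed.

Lemma lebesgue_measure_reflect_unit (R : realType) (s : R)
    (A : set (measurableTypeR R)) : s ^+ 2 = 1 ->
  measurable A -> lebesgue_measure (reflect_unit s @^-1` A) = lebesgue_measure A.
Proof.
move=> /sqr1_cases[] -> mA.
  by rewrite (_ : _ @^-1` A = A)//; apply/seteqP; split => x /=; rewrite reflect_unit1.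
rewrite -[LHS]/(pushforward lebesgue_measure (reflect_unit (-1) : R -> measurableTypeR R) A).
apply/esym/lebesgue_measure_unique => //=; first exact: measurable_reflect_unit.
move=> _ X [[a b]] _ <- /=.
rewrite /pushforward /= (_ : _ @^-1` _ = `[1 - b, 1 - a[%classic); last first.
  apply/seteqP; split => x /=; rewrite !in_itv/= reflect_unitN1; lra.
rewrite !lebesgue_measure_itv /= !lte_fin.
rewrite (_ : (1 - b < 1 - a) = (a < b)); last by apply/idP/idP; lra.
by case: ifP => // _; rewrite -!EFinD; congr EFin; ring.
Qed.

Definition reflect_square (R : realType) (s : R * R) (x : plane R) : plane R :=
  (reflect_unit s.1 x.1, reflect_unit s.2 x.2).

Lemma measurable_reflect_square (R : realType) (s : R * R) :
  measurable_fun setT (reflect_square s : plane R -> plane R).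
Proof.
apply/measurable_fun_pairP; split.
  exact: (measurableT_comp (measurable_reflect_unit s.1) measurable_fst).
exact: (measurableT_comp (measurable_reflect_unit s.2) measurable_snd).
Qed.

Lemma lebesgue2_reflect_square (R : realType) (s : R * R) (A : set (plane R)) :
  s.1 ^+ 2 = 1 -> s.2 ^+ 2 = 1 ->
  measurable A -> pushforward lebesgue2 (reflect_square s) A = lebesgue2 A.
Proof.
move=> s1 s2 mA.
have mf := @measurable_reflect_square R s.
apply/esym/product_measure_unique => //= X Y mX mY.
transitivity (lebesgue2 ((reflect_unit s.1 @^-1` X) `*` (reflect_unit s.2 @^-1` Y))) => //.
have mp t (Z : set (measurableTypeR R)) : measurable Z -> measurable (reflect_unit t @^-1` Z).
  by move=> mZ; rewrite -[_ @^-1` _]setTI; exact: measurable_reflect_unit.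
rewrite /lebesgue2 product_measure1E; [|exact: mp mX|exact: mp mY].
by congr (_ * _)%E; exact: lebesgue_measure_reflect_unit.
Qed.

Lemma measurable_unit_square (R : realType) : measurable (unit_square : set (plane R)).
Proof. by apply: measurableX; exact: measurable_itv. Qed.

Lemma reflect_square_preimage_square (R : realType) (s : R * R) :
  s.1 ^+ 2 = 1 -> s.2 ^+ 2 = 1 -> reflect_square s @^-1` unit_square = unit_square.
Proof.
move=> /sqr1_cases s1 /sqr1_cases s2.
have H t x : t = 1 \/ t = -1 -> (0 <= reflect_unit t x <= 1) = (0 <= x <= 1).
  by case=> ->; rewrite (reflect_unit1, reflect_unitN1) //; apply/idP/idP; lra.
by apply/seteqP; split => -[x y]; rewrite /unit_square /= !in_itv /= !H.
Qed.

Lemma ge0_integral_reflect_square (R : realType) (s : R * R) (f : plane R -> \bar R) :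
  s.1 ^+ 2 = 1 -> s.2 ^+ 2 = 1 ->
  measurable_fun (unit_square : set (plane R)) f -> (forall x, (0 <= f x)%E) ->
  (\int[lebesgue2]_(x in unit_square) f (reflect_square s x) =
   \int[lebesgue2]_(x in unit_square) f x)%E.
Proof.
move=> s1 s2 mf f0.
have := @ge0_integral_pushforward _ _ _ _ R _ (measurable_reflect_square s) lebesgue2 unit_square f
  (@measurable_unit_square R) mf (fun x _ => f0 x).
rewrite (reflect_square_preimage_square s1 s2) => <-.
apply: eq_measure_integral => [|mf2 A mA _]; first exact: measurable_reflect_square.
exact: lebesgue2_reflect_square.
Qed.

Lemma measurable_fun_reflect_square (R : realType) (s : R * R) d (T : measurableType d)
    (f : plane R -> T) :
  s.1 ^+ 2 = 1 -> s.2 ^+ 2 = 1 ->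
  measurable_fun (unit_square : set (plane R)) f -> measurable_fun unit_square (f \o reflect_square s).
Proof.
move=> s1 s2 mf.
apply: (@measurable_comp _ _ _ _ _ _ unit_square) => //.
- exact: measurable_unit_square.
- by move=> _ [x xS <-]; rewrite -[unit_square](reflect_square_preimage_square s1 s2) in xS.
- by apply: measurable_funTS; exact: measurable_reflect_square.
Qed.

(** The positive and negative parts of f have the same integrals, finite or
    not, as those of its reflection. *)
Lemma integral_reflect_square (R : realType) (s : R * R) (f : plane R -> \bar R) :
  s.1 ^+ 2 = 1 -> s.2 ^+ 2 = 1 -> measurable_fun (unit_square : set (plane R)) f ->
  (\int[lebesgue2]_(x in unit_square) f (reflect_square s x) =
   \int[lebesgue2]_(x in unit_square) f x)%E.
Proof.
move=> s1 s2 mf; rewrite integralE [RHS]integralE; congr (_ - _)%E.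
  rewrite -(ge0_integral_reflect_square s1 s2 (measurable_funepos mf) (funepos_ge0 f)).
  by apply: eq_integral => x _; rewrite !funeposE.
rewrite -(ge0_integral_reflect_square s1 s2 (measurable_funeneg mf) (funeneg_ge0 f)).
by apply: eq_integral => x _; rewrite !funenegE.
Qed.

Lemma integrable_reflect_square (R : realType) (s : R * R) (f : R * R -> R) :
  s.1 ^+ 2 = 1 -> s.2 ^+ 2 = 1 ->
  lebesgue2.-integrable unit_square (EFin \o f) ->
  lebesgue2.-integrable unit_square (EFin \o (f \o reflect_square s)).
Proof.
move=> s1 s2 /integrableP[mf intf].
apply/integrableP; split; first exact: (measurable_fun_reflect_square s1 s2 mf).
rewrite (ge0_integral_reflect_square (f := fun x => `|(EFin \o f) x|%E) s1 s2) //.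
exact: measurableT_comp.
Qed.

(** Reflection of the torus about 0 by the signs s.1 and s.2.  It agrees modulo
    the lattice with [reflect_square s], which preserves the square. *)
Definition reflect2 (R : realType) (s x : R * R) : R * R := (s.1 * x.1, s.2 * x.2).

Lemma eqT2_reflect_square (R : realType) (s x : R * R) : s.1 ^+ 2 = 1 -> s.2 ^+ 2 = 1 ->
  eqT2 (reflect_square s x) (reflect2 s x).
Proof.
have H (t u : R) : t ^+ 2 = 1 -> exists m : int, reflect_unit t u - t * u = m%:~R.
  move=> /sqr1_cases[] ->; first by exists 0; rewrite reflect_unit1; ring.
  by exists 1; rewrite reflect_unitN1; ring.
move=> /(H _ x.1)[m mE] /(H _ x.2)[n nE].
by exists m, n; rewrite -mE -nE.
Qed.

Lemma intT2_reflect2 (R : realType) (s : R * R) (f : R * R -> R) :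
  s.1 ^+ 2 = 1 -> s.2 ^+ 2 = 1 -> periodic2 f ->
  measurable_fun (unit_square : set (plane R)) f -> intT2 (f \o reflect2 s) = intT2 f.
Proof.
move=> s1 s2 pf mf; rewrite /intT2 /Rintegral; congr fine.
rewrite -(integral_reflect_square (f := EFin \o f) s1 s2); last exact/measurable_EFinP.
by apply: eq_integral => x _ /=; congr EFin; apply/esym/pf/eqT2_reflect_square.
Qed.

Lemma integrable_reflect2 (R : realType) (s : R * R) (f : R * R -> R) :
  s.1 ^+ 2 = 1 -> s.2 ^+ 2 = 1 -> periodic2 f ->
  lebesgue2.-integrable unit_square (EFin \o f) ->
  lebesgue2.-integrable unit_square (EFin \o (f \o reflect2 s)).
Proof.
move=> s1 s2 pf intf.
rewrite (_ : f \o _ = f \o reflect_square s); first exact: integrable_reflect_square.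
by apply/funext => x /=; apply/esym/pf/eqT2_reflect_square.
Qed.

Lemma measurable_wave (R : realType) m n (th : R) (D : set (plane R)) :
  measurable_fun D (wave m n th : plane R -> R).
Proof.
apply: measurable_funTS; apply: measurableT_comp.
  by apply: continuous_measurable_fun; exact: continuous_cos.
apply: measurable_funD => //; apply: measurable_funM => //.
by apply: measurable_funD; apply: measurable_funM => //.
Qed.

Lemma bounded_wave (R : realType) m n (th : R) (D : set (plane R)) :
  [bounded wave m n th x | x in D].
Proof.
exists 1; split; first exact: num_real.
by move=> M M1 x _; apply: le_trans (ltW M1); exact: cos_max.
Qed.

Lemma lebesgue2_unit_square (R : realType) : lebesgue2 (@unit_square R) = 1%E.
Proof.
rewrite /lebesgue2 product_measure1E; try exact: measurable_itv.
have E : lebesgue_measure (`[0 : R, 1]%classic) = 1%E.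
  by rewrite lebesgue_measure_itv /= lte_fin ltr01 sube0.
by rewrite -[RHS]mule1; congr (_ * _)%E; exact: E.
Qed.

Lemma lebesgue2_unit_square_lty (R : realType) : (lebesgue2 (@unit_square R) < +oo)%E.
Proof. by rewrite lebesgue2_unit_square ltry. Qed.

Lemma integrable_mul_wave (R : realType) (f : R * R -> R) m n (th : R) :
  lebesgue2.-integrable unit_square (EFin \o f) ->
  lebesgue2.-integrable unit_square (EFin \o (fun x => f x * wave m n th x)).
Proof.
move=> fi; have := @integrableMl _ _ _ _ _ (@measurable_unit_square R) _ _ fi
  (@measurable_wave R m n th _) (@bounded_wave R m n th _).
by apply: eq_integrable => [|x _ /=]; [exact: measurable_unit_square|rewrite EFinM].
Qed.

(** * A function orthogonal to all plane waves vanishes *)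

Lemma wave_prod (R : realType) k l (t : R) m n th x :
  wave k l t x * wave m n th x =
  2^-1 * (wave (m + k) (n + l) (th + t) x + wave (m - k) (n - l) (th - t) x).
Proof.
rewrite /wave !rmorphB !rmorphD /=.
set a := 2 * pi * (k%:~R * x.1 + l%:~R * x.2) + t.
set b := 2 * pi * (m%:~R * x.1 + n%:~R * x.2) + th.
rewrite (_ : _ + (th + t) = b + a); last by rewrite /a /b; ring.
rewrite (_ : _ + (th - t) = b - a); last by rewrite /a /b; ring.
by rewrite (cosD b a) (cosB b a); field.
Qed.

(** Nonnegative, with maximum 4 exactly on z + Z^2 (see [bumpE]); written with
    waves so that its powers expand into waves. *)
Definition bump (R : realType) (z x : R * R) : R :=
  (1 + wave 1 0 (- (2 * pi * z.1)) x) * (1 + wave 0 1 (- (2 * pi * z.2)) x).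

Section wave_orthogonality.
Variables (R : realType) (g : R * R -> R).

Let orthogonal (psi : R * R -> R) :=
  lebesgue2.-integrable unit_square (EFin \o (fun x => g x * psi x)) /\
  intT2 (fun x => g x * psi x) = 0.

Let mS := @measurable_unit_square R.

Lemma orthogonal_lin u v c : orthogonal u -> orthogonal v -> orthogonal (fun x => u x + c * v x).
Proof.
move=> [iu Ou] [iv Ov].
have iv' : lebesgue2.-integrable unit_square (EFin \o (fun x => c * (g x * v x))).
  have := integrableZl mS c iv; apply: eq_integrable => // x _ /=.
have E : (fun x => g x * (u x + c * v x)) = (fun x => g x * u x + c * (g x * v x)).
  by apply/funext => x; ring.
split; rewrite E.
  have := integrableD mS iu iv'; apply: eq_integrable => // x _ /=.
rewrite /intT2 RintegralD //.
by rewrite -/(intT2 _) Ou add0r RintegralZl // -/(intT2 _) Ov mulr0.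
Qed.

Lemma orthogonal_mul psi k l (t : R) :
  (forall m n th, orthogonal (fun x => psi x * wave m n th x)) ->
  forall m n th, orthogonal (fun x => psi x * (1 + wave k l t x) * wave m n th x).
Proof.
move=> H m n th.
rewrite (_ : (fun x => _) = fun x => psi x * wave m n th x +
   2^-1 * (psi x * wave (m + k) (n + l) (th + t) x +
           1 * (psi x * wave (m - k) (n - l) (th - t) x))).
  by apply: orthogonal_lin => //; apply: orthogonal_lin.
by apply/funext => x; rewrite -mulrA mulrDl wave_prod; ring.
Qed.

Hypothesis Og : forall m n th, orthogonal (wave m n th).

(** The powers of the bump are not expanded: multiplying by one factor
    1 + wave turns a product with a wave into a combination of such products,
    by the product-to-sum formula. *)
Lemma orthogonal_bump z k : orthogonal (fun x => bump z x ^+ k).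
Proof.
have H : forall m n th, orthogonal (fun x => bump z x ^+ k * wave m n th x).
  elim: k => [|k IH] m n th.
    by rewrite (_ : (fun x => _) = wave m n th) //; apply/funext => x; rewrite mul1r.
  have := @orthogonal_mul _ 1 0 (- (2 * pi * z.1)) IH.
  move=> /(@orthogonal_mul _ 0 1 (- (2 * pi * z.2))) /(_ m n th).
  congr orthogonal; apply/funext => x; rewrite exprSr /bump; ring.
have := H 0 0 0; congr orthogonal; apply/funext => x.
by rewrite /wave !mulr0z !mul0r !addr0 mulr0 cos0 mulr1.
Qed.

End wave_orthogonality.

Lemma bumpE (R : realType) (z x : R * R) :
  bump z x = (1 + cos (2 * pi * (x.1 - z.1))) * (1 + cos (2 * pi * (x.2 - z.2))).
Proof. by rewrite /bump /wave; congr ((1 + cos _) * (1 + cos _)); ring. Qed.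

Lemma bump_ge0 (R : realType) (z x : R * R) : 0 <= bump z x.
Proof.
by rewrite bumpE; apply: mulr_ge0; rewrite addrC -lerBlDr sub0r cos_geN1.
Qed.

Lemma cos_2pi_norm_le (R : realType) (d u : R) : 0 <= d -> `|u| <= 2^-1 ->
  d <= `|u| -> cos (2 * pi * u) <= cos (2 * pi * d).
Proof.
move=> d0 u1 du; have p0 := pi_gt0 R.
have -> : cos (2 * pi * u) = cos (2 * pi * `|u|).
  by rewrite -cos_norm normrM gtr0_norm // mulr_gt0.
have A (v : R) : 0 <= v -> v <= 2^-1 -> 2 * pi * v \in `[0, pi]%R.
  move=> v0 v1; rewrite in_itv /=; apply/andP; split.
    exact: (mulr_ge0 (mulr_ge0 (ler0n R 2) (ltW p0)) v0).
  by have := ler_wpM2l (ltW p0) v1; lra.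
rewrite leNgt; apply/negP; rewrite ltr_cos ?A //; last exact: le_trans u1.
by rewrite ltNge ler_pM2l ?mulr_gt0 // du.
Qed.

(** Modulo the integers u lies in [-1/2, 1/2], where the cosine decreases with
    the absolute value. *)
Lemma cos_2pi_near_int (R : realType) (d u : R) : 0 <= d ->
  cos (2 * pi * d) < cos (2 * pi * u) -> exists k : int, `|u - k%:~R| < d.
Proof.
move=> d0 h; pose k := Num.floor (u + 2^-1); exists k.
rewrite ltNge; apply/negP => hd.
have := Num.Theory.floor_le (u + 2^-1); have := Num.Theory.lt_succ_floor (u + 2^-1).
rewrite -/k intrD /= => k1 k2.
have : cos (2 * pi * (u - k%:~R)) <= cos (2 * pi * d).
  by apply: cos_2pi_norm_le => //; rewrite ler_norml; apply/andP; split; lra.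
rewrite leNgt => /negP; apply; apply: lt_le_trans h _.
by rewrite -(@cosD_int2pi R (2 * pi * (u - k%:~R)) k) le_eqVlt; apply/orP; left;
  apply/eqP; congr cos; ring.
Qed.

(** The threshold is 2 (1 + cos (2 pi d)) = 4 cos (pi d) ^ 2.  Each factor of
    the bump is at most 2, so above the threshold each exceeds
    1 + cos (2 pi d), which localizes both coordinates modulo 1. *)
Lemma bump_gt_near (R : realType) (z x : R * R) (d : R) :
  0 < d -> d <= 4^-1 -> 4 * cos (pi * d) ^+ 2 < bump z x ->
  exists2 y, eqT2 x y & `|y.1 - z.1| < d /\ `|y.2 - z.2| < d.
Proof.
move=> d0 d1; have p0 := pi_gt0 R.
set c := cos (pi * d) => h.
have cd : cos (2 * pi * d) = 2 * c ^+ 2 - 1.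
  by rewrite -mulrA mulr_natl cos_mulr2n -/c; ring.
have h1 (a b : R) : 4 * c ^+ 2 < (1 + cos a) * (1 + cos b) -> cos (2 * pi * d) < cos a :> R.
  have := cos_geN1 a; have := cos_le1 b; have := cos_geN1 b; rewrite cd; nra.
rewrite bumpE in h.
have [k hk] := cos_2pi_near_int (ltW d0) (h1 _ _ h).
rewrite [ltRHS]mulrC in h.
have [l hl] := cos_2pi_near_int (ltW d0) (h1 _ _ h).
exists (x.1 - k%:~R, x.2 - l%:~R).
  by exists k, l; rewrite [LHS]surjective_pairing /=; congr pair; ring.
by split => /=; rewrite addrAC.
Qed.

(** On the box of half the size the lower bound (1 + cos (pi d)) ^ 2 exceeds
    the threshold 4 cos (pi d) ^ 2 of [bump_gt_near], because
    cos (pi d) < 1. *)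
Lemma bump_ge_box (R : realType) (z x : R * R) (d : R) :
  0 < d -> d <= 4^-1 -> `|x.1 - z.1| <= d / 2 -> `|x.2 - z.2| <= d / 2 ->
  (1 + cos (pi * d)) ^+ 2 <= bump z x.
Proof.
move=> d0 d1 h1 h2; have p0 := pi_gt0 R.
have H (u : R) : `|u| <= d / 2 -> cos (pi * d) <= cos (2 * pi * u) :> R.
  move=> hu; have -> : pi * d = 2 * pi * (d / 2) :> R by field.
  rewrite (_ : cos (2 * pi * u) = cos (2 * pi * `|u|)); last first.
    by rewrite -[LHS]cos_norm normrM gtr0_norm // mulr_gt0.
  have E : `|d / 2| = d / 2 by apply: ger0_norm; lra.
  by apply: cos_2pi_norm_le; rewrite // E //; lra.
rewrite bumpE expr2; have c1 := cos_geN1 (pi * d).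
by apply: ler_pM; rewrite ?(lerD2l, H) //; lra.
Qed.

Lemma bernoulli (R : realType) (e : R) n : 0 <= e -> 1 + n%:R * e <= (1 + e) ^+ n.
Proof.
move=> e0; elim: n => [|n IH]; first by rewrite mul0r addr0 expr0.
rewrite exprS -[n.+1%:R]natr1; have n0 : 0 <= n%:R :> R by [].
have := ler_wpM2l (_ : 0 <= 1 + e) IH; nra.
Qed.

Lemma box_measure (R : realType) (a b r : R) : 0 <= r ->
  lebesgue2 (`[a, a + r] `*` `[b, b + r])%classic = (r * r)%:E.
Proof.
move=> r0; rewrite /lebesgue2 product_measure1E; try exact: measurable_itv.
have E (c : R) : lebesgue_measure (`[c, c + r]%classic) = r%:E.
  rewrite lebesgue_measure_itv /= lte_fin ltrDl.
  case: ifPn => [_|]; first by rewrite -EFinD addrAC subrr add0r.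
  by rewrite -leNgt => r0'; congr EFin; apply/eqP; rewrite eq_le r0 r0'.
by rewrite EFinM; congr (_ * _)%E; exact: E.
Qed.

(** With u = g y and t the bump at y divided by its threshold: where t > 1 the
    product u t ^ n is positive, and where t <= 1 it is at least - |u|.  On a
    set of points (marked by b) where t >= rho it is at least e rho ^ n. *)
Lemma kernel_pointwise_bound (R : realType) (e rho u t : R) (b : bool) n :
  0 <= e -> 0 <= t -> 0 <= rho -> (b -> rho <= t) -> (b || (1 < t) -> e < u) ->
  e * rho ^+ n * b%:R - `|u| <= u * t ^+ n.
Proof.
move=> e0 t0 rho0 bt eu; have u0 := normr_ge0 u.
have tn0 : 0 <= t ^+ n by exact: exprn_ge0.
case: b bt eu => /= [bt eu|_ eu]; rewrite (mulr1, mulr0).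
  have rt : rho ^+ n <= t ^+ n by apply: lerXn2r; rewrite ?nnegrE //; exact: bt.
  have := ler_pM e0 (exprn_ge0 n rho0) (ltW (eu isT)) rt; lra.
have [t1|/eu eu'] := leP t 1; last by have := mulr_ge0 (le_trans e0 (ltW eu')) tn0; lra.
have tn1 : t ^+ n <= 1 by exact: exprn_ile1.
have := ler_norm (- u); rewrite normrN; nra.
Qed.

(** If g x > 0, then for some d the function g exceeds e = g x / 2 wherever the
    bump exceeds its threshold M = 4 cos (pi d) ^ 2, and the bump is at least
    rho M, rho > 1, on a box V of positive measure.  Integrating
    [kernel_pointwise_bound], the orthogonality gives
    0 >= e rho ^ n |V| - int |g| for all n, which is absurd. *)
Lemma wave_orthogonal_le0 (R : realType) (g : R * R -> R) (x : R * R) :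
  periodic2 g -> lebesgue2.-integrable unit_square (EFin \o g) ->
  (forall m n th, intT2 (fun y => g y * wave m n th y) = 0) ->
  {for x, continuous g} -> g x <= 0.
Proof.
move=> pg ig og cg; rewrite leNgt; apply/negP => gx0.
have mS := @measurable_unit_square R.
have Og m n th :
  lebesgue2.-integrable unit_square (EFin \o (fun x => g x * wave m n th x)) /\
  intT2 (fun x => g x * wave m n th x) = 0.
  by split; [exact: integrable_mul_wave|exact: og].
have {og} Ob := orthogonal_bump Og.
pose e := g x / 2.
have e0 : 0 < e by rewrite divr_gt0.
have [d [d0 d1] gd] : exists2 d : R, 0 < d /\ d <= 4^-1 &
   forall y, `|y.1 - x.1| < d -> `|y.2 - x.2| < d -> e < g y.
  have : \forall y \near x, e < g y.
    apply: (cg [set u | e < u]); apply: lt_nbhsr => //.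
    by rewrite /e ltr_pdivrMr // mulr_natr mulr2n ltrDl.
  move=> /nbhs_ballP[r /= r0 hr]; exists (Num.min r 4^-1).
    split; last by rewrite ge_min lexx orbT.
    by rewrite lt_min; apply/andP; split => //; rewrite invr_gt0.
  move=> y; rewrite !lt_min => /andP[y1 _] /andP[y2 _]; apply: hr.
  by split; rewrite -ball_normE /ball_ /= distrC.
have p0 := pi_gt0 R.
pose c := cos (pi * d).
have c0 : 0 < c.
  apply: cos_gt0_pihalf; have := ler_wpM2l (ltW p0) d1; have := mulr_gt0 p0 d0; lra.
have c1 : c < 1.
  have := mulr_gt0 p0 d0; have := ler_wpM2l (ltW p0) d1 => h1 h2.
  rewrite -cos0 ltr_cos ?in_itv //=; apply/andP; split; lra.
pose M := 4 * c ^+ 2; have M0 : 0 < M by rewrite mulr_gt0 // exprn_gt0.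
pose rho := (1 + c) ^+ 2 / M.
have rho1 : 0 < rho - 1 by rewrite subr_gt0 ltr_pdivlMr // mul1r /M; nra.
(* The representative of x in [0, 1)^2: a box with lower left corner z and side
   r lies in the unit square. *)
pose z : R * R := (x.1 - (Num.floor x.1)%:~R, x.2 - (Num.floor x.2)%:~R).
have zE (u : R) : 0 <= u - (Num.floor u)%:~R < 1.
  have := Num.Theory.floor_le u; have := Num.Theory.lt_succ_floor u.
  rewrite intrD /=; lra.
have {}gd y : `|y.1 - z.1| < d -> `|y.2 - z.2| < d -> e < g y.
  move=> y1 y2; pose y' := (y.1 + (Num.floor x.1)%:~R, y.2 + (Num.floor x.2)%:~R).
  rewrite -(pg y' y).
    have E1 : y'.1 - x.1 = y.1 - z.1 by rewrite /y' /z /=; ring.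
    have E2 : y'.2 - x.2 = y.2 - z.2 by rewrite /y' /z /=; ring.
    by apply: gd; rewrite ?E1 ?E2.
  exists (Num.floor x.1), (Num.floor x.2).
  by rewrite [LHS]surjective_pairing /=; congr pair; ring.
have gb y : M < bump z y -> e < g y.
  move=> /(bump_gt_near d0 d1)[y' yy' [y1 y2]].
  by rewrite (pg _ _ yy'); exact: gd.
pose r := Num.min (d / 2) (Num.min (1 - z.1) (1 - z.2)).
have [/andP[z10 z11] /andP[z20 z21]] := (zE x.1, zE x.2).
have r0 : 0 < r by rewrite !lt_min divr_gt0 // !subr_gt0 z11 z21.
have rd : r <= d / 2 by rewrite ge_min lexx.
have rz1 : z.1 + r <= 1.
  by rewrite addrC -lerBrDr /r ge_min [X in _ || X]ge_min lexx orbT.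
have rz2 : z.2 + r <= 1.
  by rewrite addrC -lerBrDr /r ge_min [X in _ || X]ge_min lexx !orbT.
pose V : set (plane R) := `[z.1, z.1 + r] `*` `[z.2, z.2 + r].
have mV : measurable V by apply: measurableX; exact: measurable_itv.
have VS : V `<=` unit_square.
  move=> [y1 y2]; rewrite /V /unit_square /= !in_itv /= => -[/andP[? ?] /andP[? ?]].
  by split; apply/andP; split; move: z10 z20 rz1 rz2 => /=; lra.
pose p y := bump z y / M.
have pge0 y : 0 <= p y by rewrite divr_ge0 // ?bump_ge0 // ltW.
have key n y : e * rho ^+ n * \1_V y - `|g y| <= M^-1 ^+ n * (g y * bump z y ^+ n).
  have -> : M^-1 ^+ n * (g y * bump z y ^+ n) = g y * p y ^+ n.
    by rewrite /p (exprMn n (bump z y)) mulrCA [M^-1 ^+ n * _]mulrC.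
  have VP : y \in V -> `|y.1 - z.1| <= d / 2 /\ `|y.2 - z.2| <= d / 2.
    rewrite inE /V /= !in_itv /= => -[/andP[? ?] /andP[? ?]].
    by move: rd; rewrite !ger0_norm /=; lra.
  rewrite indicE; apply: kernel_pointwise_bound => //; first exact: ltW.
  - by rewrite -(subrK 1 rho) addr_ge0 // ltW.
  - by move=> /VP[? ?]; rewrite ler_pM2r ?invr_gt0 //; exact: bump_ge_box.
  - case/orP => [/VP[h1 h2]|]; last by rewrite ltr_pdivlMr // mul1r => /gb.
    have dd : d / 2 < d by lra.
    by apply: gd; apply: le_lt_trans dd.
have ign : lebesgue2.-integrable unit_square (EFin \o (fun y => `|g y|)).
  exact: integrable_norm ig.
have iV : lebesgue2.-integrable unit_square (EFin \o (\1_V : plane R -> R)).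
  apply: measurable_bounded_integrable => //.
  - exact: lebesgue2_unit_square_lty.
  - exists 1; split; first exact: num_real.
    move=> t t1 y _ /=; rewrite indicE; case: (_ \in _) => /=; rewrite ?normr1 ?normr0; lra.
have VE : intT2 (\1_V : plane R -> R) = r * r.
  rewrite /intT2 /Rintegral integral_indic // setIidl //.
  have H := @box_measure R z.1 z.2 r (ltW r0).
  by rewrite -[RHS]/(fine (r * r)%:E); congr fine; exact: H.
pose C := intT2 (fun y => `|g y|).
have bound n : e * rho ^+ n * (r * r) <= C.
  have [ib ib0] := Ob z n.
  have iL : lebesgue2.-integrable unit_square (EFin \o (fun y => e * rho ^+ n * \1_V y)).
    have := integrableZl mS (e * rho ^+ n) iV; apply: eq_integrable => // y _ /=.
  have iR : lebesgue2.-integrable unit_square (EFin \o (fun y => M^-1 ^+ n * (g y * bump z y ^+ n))).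
    have := integrableZl mS (M^-1 ^+ n) ib; apply: eq_integrable => // y _ /=.
  have iD : lebesgue2.-integrable unit_square (EFin \o (fun y => e * rho ^+ n * \1_V y - `|g y|)).
    have := integrableB mS iL ign; apply: eq_integrable => // y _ /=.
  have ER : intT2 (fun y => M^-1 ^+ n * (g y * bump z y ^+ n)) = 0.
    by rewrite /intT2 (RintegralZl _ mS ib) (ib0 : Rintegral _ _ _ = 0) mulr0.
  have EL : intT2 (fun y => e * rho ^+ n * \1_V y - `|g y|) =
      e * rho ^+ n * (r * r) - C.
    rewrite /intT2 (RintegralB mS iL ign) (RintegralZl _ mS iV).
    by rewrite (VE : Rintegral _ _ _ = _).
  have : intT2 (fun y => e * rho ^+ n * \1_V y - `|g y|) <=
         intT2 (fun y => M^-1 ^+ n * (g y * bump z y ^+ n)).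
    exact: (le_Rintegral mS iD iR (fun y _ => key n y)).
  by rewrite EL ER subr_le0.
have C0 : 0 <= C by apply: Rintegral_ge0.
pose q := e * (rho - 1) * (r * r).
have q0 : 0 < q by rewrite !mulr_gt0.
have [n Cn] : exists n : nat, C / q < n%:R.
  by exists (Num.bound (C / q)); apply: archi_boundP; rewrite divr_ge0 // ltW.
have er0 : 0 <= e * (r * r) by apply: mulr_ge0; [exact: ltW|rewrite mulr_ge0 // ltW].
have := bernoulli n (ltW rho1); rewrite [1 + (rho - 1)]addrC subrK => b.
have b' : n%:R * (rho - 1) <= rho ^+ n by apply: le_trans b; rewrite lerDr.
have := ler_wpM2l er0 b'.
have -> : e * (r * r) * (n%:R * (rho - 1)) = n%:R * q by rewrite /q; ring.
have -> : e * (r * r) * rho ^+ n = e * rho ^+ n * (r * r) by ring.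
move=> /le_trans /(_ (bound n)); rewrite leNgt => /negP; apply.
by rewrite -ltr_pdivrMr.
Qed.

(** * The Green function is even in each coordinate *)

Lemma reflect2_linear (R : realType) (s x y : R * R) (a : R) :
  reflect2 s (a *: x + y) = a *: reflect2 s x + reflect2 s y.
Proof. by rewrite /reflect2 /= !mulrDr !scalerAr. Qed.

Lemma reflect2K (R : realType) (s : R * R) : s.1 ^+ 2 = 1 -> s.2 ^+ 2 = 1 ->
  involutive (reflect2 s).
Proof.
move=> s1 s2 [x y]; rewrite /reflect2 /= !mulrA -!expr2 s1 s2.
by rewrite !mul1r.
Qed.

Lemma reflect2B (R : realType) (s x y : R * R) :
  reflect2 s (x - y) = reflect2 s x - reflect2 s y.
Proof. by rewrite /reflect2 /= !mulrBr. Qed.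

Lemma reflect2Z (R : realType) (s v : R * R) (k : R) :
  reflect2 s (k *: v) = k *: reflect2 s v.
Proof. by apply: injective_projections; rewrite /= /GRing.scale /= mulrCA. Qed.

Lemma reflect2_sum (R : realType) (I : finType) (P : pred I) (s : R * R) (f : I -> R * R) :
  reflect2 s (\sum_(i | P i) f i) = \sum_(i | P i) reflect2 s (f i).
Proof.
apply: (big_morph (reflect2 s)) => [x y|]; first by rewrite -[x]scale1r reflect2_linear !scale1r.
by rewrite /reflect2 /= !mulr0.
Qed.

Lemma lattice_reflect2 (R : realType) (s x : R * R) : s.1 ^+ 2 = 1 -> s.2 ^+ 2 = 1 ->
  lattice x -> lattice (reflect2 s x).
Proof.
move=> /sqr1_cases s1 /sqr1_cases s2 [m [n ->]].
have H (t : R) (k : int) : t = 1 \/ t = -1 -> exists l : int, t * k%:~R = l%:~R.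
  case=> ->; first by exists k; rewrite mul1r.
  by exists (- k); rewrite mulN1r mulrNz.
have [m' mE] := H _ m s1; have [n' nE] := H _ n s2.
by exists m', n'; rewrite /reflect2 /= mE nE.
Qed.

Lemma continuous_reflect2 (R : realType) (s : R * R) : continuous (reflect2 s).
Proof.
move=> x.
have A : (s.1 * y.1) @[y --> x] --> s.1 * x.1 by apply: cvgM; [exact: cvg_cst|exact: cvg_fst].
have B : (s.2 * y.2) @[y --> x] --> s.2 * x.2 by apply: cvgM; [exact: cvg_cst|exact: cvg_snd].
exact: (cvg_pair A B).
Qed.

Lemma wave_reflect2 (R : realType) (s : R * R) m n (th : R) :
  s.1 ^+ 2 = 1 -> s.2 ^+ 2 = 1 ->
  exists m' n' : int, [/\ m' ^+ 2 = m ^+ 2, n' ^+ 2 = n ^+ 2 &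
    wave m n th \o reflect2 s = wave m' n' th].
Proof.
have H (t : R) (k : int) : t ^+ 2 = 1 ->
    exists2 l : int, l ^+ 2 = k ^+ 2 & forall u, k%:~R * (t * u) = l%:~R * u.
  move=> /sqr1_cases[] ->; first by exists k => // u; rewrite mul1r.
  by exists (- k); [rewrite sqrrN|move=> u; rewrite mulrNz; ring].
move=> s1 s2; have [m' m2 mE] := H _ m s1; have [n' n2 nE] := H _ n s2.
exists m', n'; split => //.
by apply/funext => x; rewrite /wave /= mE nE.
Qed.

Section green_symmetry.
Variables (R : realType) (F : R * R -> R).
Hypothesis hF : green_function F.

Let mS := @measurable_unit_square R.

Lemma green_periodic : periodic2 F. Proof. by case: hF. Qed.

Lemma integrable_green_wave m n th :
  lebesgue2.-integrable unit_square (EFin \o (fun x => F x * wave m n th x)).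
Proof. by have [_ _ iF _ _] := hF; exact: integrable_mul_wave. Qed.

Lemma periodic_green_wave m n th : periodic2 (fun x => F x * wave m n th x).
Proof. by move=> x y xy; rewrite (green_periodic xy) (periodic_wave _ _ _ xy). Qed.

(** The wave is an eigenfunction of the Laplacian with eigenvalue
    - (2 pi) ^ 2 (m ^ 2 + n ^ 2), so the distributional equation, tested on
    it, computes the Fourier coefficient. *)
Lemma green_wave_coefficient m n (th : R) : m ^+ 2 + n ^+ 2 != 0 :> int ->
  intT2 (fun x => F x * wave m n th x) =
  2 * pi * ((2 * pi) ^- 2 / (m ^+ 2 + n ^+ 2)%:~R) *
    (intT2 (wave m n th) - wave m n th 0).
Proof.
move=> mn; have [_ _ _ _ H] := hF.
pose c : R := - ((2 * pi) ^- 2 / (m ^+ 2 + n ^+ 2)%:~R).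
have mn' : (m ^+ 2 + n ^+ 2)%:~R != 0 :> R by rewrite intr_eq0.
have p0 : 2 * pi != 0 :> R by rewrite mulf_neq0 // gt_eqF // pi_gt0.
have pw : periodic2 (fun x => c * wave m n th x).
  by move=> x y xy; rewrite (periodic_wave _ _ _ xy).
have := H _ pw (smooth_wave c m n th).
have -> : (fun x => F x * laplacian (fun y => c * wave m n th y) x) =
          (fun x => F x * wave m n th x).
  apply/funext => x; rewrite laplacian_wave /c opprK.
  congr (_ * _); rewrite -[RHS]mul1r; congr (_ * _).
  have E : m%:~R ^+ 2 + n%:~R ^+ 2 = (m ^+ 2 + n ^+ 2)%:~R :> R.
    by rewrite intrD !rmorphXn.
  rewrite E -mulrA [_ ^+ 2 * _%:~R]mulrC mulrA divfK // mulVf // expf_neq0 //.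
move=> ->.
have -> : intT2 (fun x => c * wave m n th x) = c * intT2 (wave m n th).
  rewrite /intT2 RintegralZl //.
  apply: measurable_bounded_integrable => //.
  - exact: lebesgue2_unit_square_lty.
  - exact: measurable_wave.
  - exact: bounded_wave.
rewrite /c; ring.
Qed.

(** For a nonconstant wave both sides are given by [green_wave_coefficient],
    whose right-hand side is the same for a wave and its reflection; the
    constant waves are already invariant. *)
Lemma green_wave_reflect2 s m n (th : R) : s.1 ^+ 2 = 1 -> s.2 ^+ 2 = 1 ->
  intT2 (fun x => F (reflect2 s x) * wave m n th x) =
  intT2 (fun x => F x * wave m n th x).
Proof.
move=> s1 s2; have [m' [n' [m2 n2 E]]] := wave_reflect2 m n th s1 s2.
transitivity (intT2 (fun x => F x * wave m' n' th x)).
  rewrite -(intT2_reflect2 s1 s2 (@periodic_green_wave m' n' th)); last first.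
    by apply/measurable_EFinP; exact: measurable_int (integrable_green_wave m' n' th).
  by congr intT2; apply/funext => x /=; rewrite -E /= reflect2K.
have [mn0|mn] := eqVneq (m ^+ 2 + n ^+ 2) 0.
  have [m0 n0] : m = 0 /\ n = 0.
    by move/eqP: mn0; rewrite paddr_eq0 ?sqr_ge0 // !sqrf_eq0 => /andP[/eqP ? /eqP ?].
  have [-> ->] : m' = 0 /\ n' = 0.
    move: m2 n2; rewrite m0 n0 expr0n /= => /eqP + /eqP.
    by rewrite !sqrf_eq0 => /eqP ? /eqP ?.
  by rewrite m0 n0.
rewrite !green_wave_coefficient ?m2 ?n2 //; congr (_ * (_ - _)).
  rewrite -E; apply: intT2_reflect2 => //; first exact: periodic_wave.
  exact: measurable_wave.
by rewrite -E /= /reflect2 /= !mulr0.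
Qed.

(** F - F o s changes sign under s, so it suffices that it is nonpositive
    everywhere off the lattice. *)
Lemma green_reflect2 s x : s.1 ^+ 2 = 1 -> s.2 ^+ 2 = 1 -> ~ lattice x ->
  F (reflect2 s x) = F x.
Proof.
move=> s1 s2.
have [pF sF iF _ _] := hF.
suff le y : ~ lattice y -> F y - F (reflect2 s y) <= 0.
  move=> xL; have xL' : ~ lattice (reflect2 s x).
    by move=> /(lattice_reflect2 s1 s2); rewrite reflect2K.
  have H1 := le _ xL; have := le _ xL'; rewrite reflect2K // => H2; lra.
move=> yL.
have pFs : periodic2 (F \o reflect2 s).
  by move=> u v uv /=; apply: pF; rewrite /eqT2 -reflect2B; exact: lattice_reflect2.
have iFs := integrable_reflect2 s1 s2 pF iF.
have ig : lebesgue2.-integrable unit_square (EFin \o (fun y => F y - F (reflect2 s y))).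
  by have := integrableB mS iF iFs; apply: eq_integrable => // u _ /=.
have cF u : ~ lattice u -> {for u, continuous F} by move=> uL; have [H _] := sF 0; exact: (H u uL).
apply: (@wave_orthogonal_le0 R (fun y => F y - F (reflect2 s y))) => //.
- by move=> u v uv; rewrite (pF u v uv) (pFs u v uv : F _ = F _).
- move=> m n th.
  have iw := integrable_green_wave m n th.
  have iws : lebesgue2.-integrable unit_square (EFin \o (fun x => F (reflect2 s x) * wave m n th x)).
    exact: (integrable_mul_wave m n th iFs).
  have -> : (fun y => (F y - F (reflect2 s y)) * wave m n th y) =
            (fun y => F y * wave m n th y - F (reflect2 s y) * wave m n th y).
    by apply/funext => u; rewrite mulrBl.
  by rewrite /intT2 (RintegralB mS iw iws) (green_wave_reflect2 m n th s1 s2 : Rintegral _ _ _ = _) subrr.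
- apply: cvgB; first exact: cF.
  apply: (@continuous_comp _ _ _ (reflect2 s) F y); first exact: continuous_reflect2.
  by apply: cF => /(lattice_reflect2 s1 s2); rewrite reflect2K.
Qed.

End green_symmetry.

(** * The gradient of the Green function and of the energy *)

Lemma near_not_lattice (R : realType) (z : R * R) :
  ~ lattice z -> \forall y \near z, ~ lattice y.
Proof.
have int_near (u : R) : (forall m : int, u <> m%:~R) ->
    \forall w \near u, forall m : int, w <> m%:~R.
  move=> um; pose k := Num.floor u.
  have k1 : k%:~R < u.
    rewrite lt_neqAle Num.Theory.floor_le andbT; apply/eqP => E.
    by apply: (um k); rewrite E.
  have k2 : u < (k + 1)%:~R by exact: Num.Theory.lt_succ_floor.
  near=> w => m wm.
  have : k%:~R < w by near: w; exact: lt_nbhsr.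
  have : w < (k + 1)%:~R by near: w; exact: lt_nbhsl.
  rewrite wm !ltr_int; lia.
move=> zL.
have [z1|/existsNP[m1 /contrapT z1]] := pselect (forall m : int, z.1 <> m%:~R).
  have := int_near _ z1 => /(@cvg_fst _ _ (nbhs z.1) (nbhs z.2)).
  move=> h; near=> y => -[m [n yE]].
  have : (forall m : int, y.1 <> m%:~R) by near: y; exact: h.
  by move=> /(_ m); rewrite yE.
have [z2|/existsNP[m2 /contrapT z2]] := pselect (forall m : int, z.2 <> m%:~R).
  have := int_near _ z2 => /(@cvg_snd _ _ (nbhs z.1) (nbhs z.2)).
  move=> h; near=> y => -[m [n yE]].
  have : (forall m : int, y.2 <> m%:~R) by near: y; exact: h.
  by move=> /(_ n); rewrite yE.
by case: zL; exists m1, m2; rewrite -z1 -z2 -surjective_pairing.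
Unshelve. all: by end_near. Qed.

Section green_gradient.
Variables (R : realType) (F : R * R -> R).
Hypothesis hF : green_function F.

Lemma green_derivable z : ~ lattice z ->
  derivable F z (1, 0) /\ derivable F z (0, 1).
Proof.
by move=> zL; have [_ sF _ _ _] := hF; have [_ [h1 h2 _ _]] := sF 1; split; [exact: h1|exact: h2].
Qed.

Lemma is_derive_green_reflect2 s z v df : s.1 ^+ 2 = 1 -> s.2 ^+ 2 = 1 ->
  ~ lattice z -> is_derive (reflect2 s z) (reflect2 s v) F df -> is_derive z v F df.
Proof.
move=> s1 s2 zL H.
apply: (@near_eq_is_derive _ _ _ (F \o reflect2 s)).
  by near=> y; apply: green_reflect2 => //; near: y; exact: near_not_lattice.
by apply: is_derive_comp_affine H => h; exact: reflect2_linear.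
Unshelve. all: by end_near. Qed.

Lemma grad_green_reflect2 s z : s.1 ^+ 2 = 1 -> s.2 ^+ 2 = 1 -> ~ lattice z ->
  grad F (reflect2 s z) = reflect2 s (grad F z).
Proof.
move=> s1 s2 zL.
have szL : ~ lattice (reflect2 s z).
  by move=> /(lattice_reflect2 s1 s2); rewrite reflect2K.
have [/derivableP dx /derivableP dy] := green_derivable zL.
have E1 : reflect2 s (1, 0) = s.1 *: ((1, 0) : R * R).
  by apply: injective_projections; rewrite /= /GRing.scale /= ?mulr0.
have E2 : reflect2 s (0, 1) = s.2 *: ((0, 1) : R * R).
  by apply: injective_projections; rewrite /= /GRing.scale /= ?mulr0.
have hx : is_derive (reflect2 s z) (1, 0) F (s.1 * pdx F z).
  apply: (is_derive_green_reflect2 s1 s2 szL); rewrite reflect2K // E1.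
  exact: is_derive_scale.
have hy : is_derive (reflect2 s z) (0, 1) F (s.2 * pdy F z).
  apply: (is_derive_green_reflect2 s1 s2 szL); rewrite reflect2K // E2.
  exact: is_derive_scale.
by rewrite /grad /pdx /pdy !derive_val.
Qed.

Lemma grad_green_periodic x y : eqT2 x y -> grad F x = grad F y.
Proof.
move=> xy; have E v : 'D_v F x = 'D_v F y.
  have pF := green_periodic hF; rewrite /derive.
  suff -> : (fun h : R => h^-1 *: ((F \o shift x) (h *: v) - F x)) =
            (fun h : R => h^-1 *: ((F \o shift y) (h *: v) - F y)) by [].
  apply/funext => h /=.
  rewrite (pF _ _ xy) (pF (h *: v + x) (h *: v + y)) //.
  by rewrite /eqT2 opprD addrACA subrr add0r.
by rewrite /grad /pdx /pdy !E.
Qed.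

End green_gradient.

Lemma degree_sqr (R : realType) (j : 'I_4) : degree j ^+ 2 = 1 :> R.
Proof. by rewrite /degree; case: ifP => _; rewrite ?expr1n ?sqrrN ?expr1n. Qed.

Lemma fst_sum (R : realType) (I : finType) (P : pred I) (f : I -> R * R) :
  (\sum_(i | P i) f i).1 = \sum_(i | P i) (f i).1.
Proof. by apply: (big_morph fst). Qed.

Lemma snd_sum (R : realType) (I : finType) (P : pred I) (f : I -> R * R) :
  (\sum_(i | P i) f i).2 = \sum_(i | P i) (f i).2.
Proof. by apply: (big_morph snd). Qed.

Lemma dipole_update (R : realType) (a : 'I_4 -> R * R) j x :
  dipole (update a j x) - dipole a = (2 * pi * degree j) *: (x - a j).
Proof.
rewrite /dipole -scalerBr -scalerA; congr (_ *: _).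
rewrite -sumrB (bigD1 j) //= big1 => [|k kj].
  by rewrite addr0 /update eqxx scalerBr.
by rewrite /update (negbTE kj) subrr.
Qed.

Section grad_energy.
Variables (R : realType) (F : R * R -> R).
Hypothesis hF : green_function F.

Definition interaction (a : 'I_4 -> R * R) (j : 'I_4) : R * R :=
  \sum_(k < 4 | k != j) degree k *: grad F (a j - a k).

Variables (a : 'I_4 -> R * R) (q : R * R) (j : 'I_4).
Hypothesis ha : distinctT2 a.

(** Each unordered pair {j, k} occurs twice in the energy, as F (x - a_k) and
    as F (a_k - x).  Since F is even the two have the same derivative, which
    turns the prefactor - pi into - 2 pi. *)
Lemma is_derive_energy (v : R * R) :
  (forall z, ~ lattice z -> derivable F z v) ->
  is_derive (a j) v (fun x => let b := update a j x in
                 renormalized_energy F b (q + (dipole b - dipole a)))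
    (2 * pi * degree j * (- (\sum_(k < 4 | k != j) degree k * 'D_v F (a j - a k))
      + (q.1 * v.1 + q.2 * v.2))).
Proof.
move=> dF.
pose D z := 'D_v F z.
have nL k k' : k != k' -> ~ lattice (a k - a k') by move=> kk; exact: ha.
(* The diagonal is filled with zeros so that both sums range over all of 'I_4. *)
have pairD (k k' : 'I_4) : is_derive (a j) v
    (fun x => if k != k' then degree k * degree k' * F (update a j x k - update a j x k') else 0)
    (if k != k' then degree k * degree k' *
       (if k == j then D (a j - a k') else if k' == j then D (a j - a k) else 0) else 0).
  case: ifPn => kk; last exact: is_derive_cst.
  apply: (@is_deriveZ _ _ _ (fun x => F (update a j x k - update a j x k')) (degree k * degree k')).
  have [kj|kj] := eqVneq k j.
    have k'j : k' != j by rewrite -kj eq_sym.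
    rewrite (_ : (fun x => _) = F \o (fun x => x - a k')); last first.
      by apply/funext => x; rewrite /update kj eqxx (negbTE k'j).
    apply: is_derive_comp_affine; first by move=> h; rewrite addrA.
    by apply/derivableP/dF/nL; rewrite eq_sym.
  have [k'j|k'j] := eqVneq k' j; last first.
    rewrite (_ : (fun x => _) = cst (F (a k - a k'))); first exact: is_derive_cst.
    by apply/funext => x; rewrite /update (negbTE kj) (negbTE k'j).
  rewrite (_ : (fun x => _) = F \o (fun x => a k - x)); last first.
    by apply/funext => x; rewrite /update k'j eqxx (negbTE kj).
  have jkL : ~ lattice (a j - a k) by apply: nL; rewrite eq_sym.
  apply: (@near_eq_is_derive _ _ _ (F \o (fun x => x - a k))); last first.
    apply: is_derive_comp_affine; first by move=> h; rewrite addrA.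
    exact/derivableP/dF.
  have : \forall x \near a j, ~ lattice (x - a k).
    have := near_not_lattice jkL; apply: (_ : continuous_at (a j) (fun x => x - a k)).
    by apply: cvgB => //; exact: cvg_cst.
  apply: filterS => x /(green_reflect2 hF (s := (-1, -1))) /=.
  rewrite sqrrN expr1n => /(_ erefl erefl) <-; congr F.
  by rewrite /reflect2 /= !mulN1r !opprB.
have sumD := @is_derive_sum _ _ _ 4 _ (a j) v _
  (fun k => @is_derive_sum _ _ _ 4 _ (a j) v _ (fun k' => pairD k k')).
pose c := 2 * pi * degree j : R.
have lin1 : is_derive (a j) v (fun x : R * R => q.1 + c * (x.1 - (a j).1)) (c * v.1).
  apply: (@is_derive_comp_affine R (R * R)%type R R id _ _ _ (c * v.1)).
  by move=> h; rewrite /= /GRing.scale /=; ring.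
have lin2 : is_derive (a j) v (fun x : R * R => q.2 + c * (x.2 - (a j).2)) (c * v.2).
  apply: (@is_derive_comp_affine R (R * R)%type R R id _ _ _ (c * v.2)).
  by move=> h; rewrite /= /GRing.scale /=; ring.
have quad := is_deriveZ 2^-1 (is_deriveD (is_deriveX 2 lin1) (is_deriveX 2 lin2)).
have total := is_deriveD (is_deriveZ (- pi) sumD) quad.
rewrite (_ : (fun x => _) = - pi \*: (\sum_(k < 4) \sum_(k' < 4) (fun x =>
   if k != k' then degree k * degree k' * F (update a j x k - update a j x k') else 0))
   + 2^-1 \*: ((fun x : R * R => q.1 + c * (x.1 - (a j).1)) ^+ 2 +
               (fun x : R * R => q.2 + c * (x.2 - (a j).2)) ^+ 2)); last first.
  apply/funext => x.
  rewrite /renormalized_energy dipole_update -/c.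
  rewrite /= !fctE /=; congr (_ + _); last by rewrite [RHS]mulrC.
  congr (_ * _); rewrite fct_sumE; apply: eq_bigr => k _.
  by rewrite fct_sumE big_mkcond.
apply: is_derive_eq total _.
rewrite !subrr /GRing.scale /= !mulr0 !addr0 !expr1.
have -> : \sum_(k < 4) \sum_(k' < 4) (if k != k' then degree k * degree k' *
       (if k == j then D (a j - a k') else if k' == j then D (a j - a k) else 0) else 0)
   = 2 * degree j * \sum_(k < 4 | k != j) degree k * D (a j - a k).
  rewrite (bigD1 j) //= mulrDl mul1r mulrDl; congr (_ + _).
    rewrite [LHS]big_mkcond [in RHS]big_mkcond /= mulr_sumr; apply: eq_bigr => k _.
    by rewrite eq_sym eqxx; case: ifP => _; rewrite ?mulr0 // mulrA.
  rewrite mulr_sumr; apply: eq_bigr => k kj.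
  rewrite (bigD1 j) //= kj eqxx (negbTE kj) big1 ?addr0 => [|k' k'j].
    by rewrite [RHS]mulrA [degree k * degree j]mulrC.
  by rewrite (negbTE k'j) mulr0 if_same.
by rewrite /c; field.
Qed.

Lemma grad_energyE : grad_energy F a q j =
  (2 * pi * degree j) *: (q - interaction a j).
Proof.
have dx := is_derive_energy (fun z zL => (green_derivable hF zL).1).
have dy := is_derive_energy (fun z zL => (green_derivable hF zL).2).
apply: injective_projections.
  rewrite /= /pdx derive_val /= /interaction fst_sum /= /GRing.scale /= mulr1 mulr0 addr0.
  by rewrite addrC.
rewrite /= /pdy derive_val /= /interaction snd_sum /= /GRing.scale /= mulr1 mulr0 add0r.
by rewrite addrC.
Qed.

End grad_energy.

(** * The velocity field and its equivariance *)

Definition mobility_solve (R : realType) (lambda : R) (d : R) (w : R * R) : R * R :=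
  (2 / (1 + lambda ^+ 2)) *: (w + (lambda * d) *: Jmul w).

(** The right-hand side of the system solved for the velocities, with the
    dipole moment of the configuration itself in the role of q. *)
Definition vortex_field (R : realType) (F : R * R -> R) (lambda : R)
    (a : 'I_4 -> R * R) (j : 'I_4) : R * R :=
  mobility_solve lambda (degree j) (degree j *: (interaction F a j - dipole a)).

(** Jmul squares to - 1, so (1 - lambda d J) (1 + lambda d J) = 1 + lambda ^ 2. *)
Lemma mobility_solveP (R : realType) (lambda d : R) (v w : R * R) :
  d ^+ 2 = 1 -> v - (lambda * d) *: Jmul v = 2 *: w -> v = mobility_solve lambda d w.
Proof.
move=> d2 /[dup] /(congr1 fst) /= E1 /(congr1 snd) /= E2.
have l0 : 1 + lambda ^+ 2 != 0 by rewrite gt_eqF // ltr_pwDl // sqr_ge0.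
rewrite /GRing.scale /= in E1 E2.
have W1 : w.1 = (v.1 - lambda * d * v.2) / 2 by rewrite E1 mulrC mulKf.
have W2 : w.2 = (v.2 - lambda * d * - v.1) / 2 by rewrite E2 mulrC mulKf.
have ld : (lambda * d) ^+ 2 = lambda ^+ 2 by rewrite exprMn d2 mulr1.
apply: injective_projections; rewrite /= /GRing.scale /= W1 W2.
  rewrite [X in _ * X](_ : _ = (1 + (lambda * d) ^+ 2) * v.1 / 2); last by field.
  by rewrite ld; field.
rewrite [X in _ * X](_ : _ = (1 + (lambda * d) ^+ 2) * v.2 / 2); last by field.
by rewrite ld; field.
Qed.

Section equivariance.
Variables (R : realType) (F : R * R -> R) (lambda : R).
Hypothesis hF : green_function F.

Lemma interaction_eq (a b : 'I_4 -> R * R) j :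
  (forall k, eqT2 (a j - a k) (b j - b k)) -> interaction F a j = interaction F b j.
Proof.
by move=> ab; apply: eq_bigr => k _; rewrite (grad_green_periodic hF (ab k)).
Qed.

Variables (s : R * R) (p : 'I_4 -> 'I_4).
Hypotheses (s1 : s.1 ^+ 2 = 1) (s2 : s.2 = - s.1) (pK : involutive p)
  (dp : forall j, degree (p j) = - degree j :> R).

Let s2' : s.2 ^+ 2 = 1. Proof. by rewrite s2 sqrrN. Qed.

(** The image of a configuration under a reflection that exchanges vortices of
    opposite degrees.  The condition s.2 = - s.1 says that exactly one
    coordinate is reflected; J then anticommutes with the reflection, which
    compensates the change of the degree in lambda d J. *)
Definition mirror (a : 'I_4 -> R * R) (j : 'I_4) : R * R := reflect2 s (a (p j)).

Lemma dipole_mirror a : dipole (mirror a) = - reflect2 s (dipole a).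
Proof.
rewrite /dipole reflect2Z -scalerN; congr (_ *: _).
rewrite reflect2_sum -sumrN (reindex_inj (inv_inj pK)); apply: eq_bigr => k _.
by rewrite /mirror pK dp reflect2Z scaleNr.
Qed.

Lemma interaction_mirror a j : distinctT2 a ->
  interaction F (mirror a) j = - reflect2 s (interaction F a (p j)).
Proof.
move=> da; rewrite /interaction reflect2_sum -sumrN (reindex_inj (inv_inj pK)) /=.
apply: eq_big => [k|k kj]; first by rewrite (inv_eq pK).
have kpj : k != p j by rewrite -(inv_eq pK).
rewrite /mirror pK dp -reflect2B grad_green_reflect2 //.
  by rewrite scaleNr reflect2Z.
by apply: da; rewrite eq_sym.
Qed.

Lemma vortex_field_mirror a j : distinctT2 a ->
  vortex_field F lambda (mirror a) j = reflect2 s (vortex_field F lambda a (p j)).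
Proof.
move=> da; rewrite /vortex_field interaction_mirror // dipole_mirror.
move: (interaction F a (p j)) (dipole a) => u D.
rewrite dp /mobility_solve reflect2Z; congr (_ *: _).
rewrite /Jmul /reflect2 s2 /=; apply: injective_projections => /=;
  rewrite /GRing.scale /=; ring.
Qed.

End equivariance.

(** * Doubly symmetric configurations *)

(** The symmetric configurations, recentred from (1/2, 1/2) to 0. *)
Definition quadrupole (R : realType) (alpha beta : R) (j : 'I_4) : R * R :=
  nth 0 [:: (alpha, beta); (- alpha, - beta); (- alpha, beta); (alpha, - beta)] j.

Lemma dipole_quadrupole (R : realType) (alpha beta : R) : dipole (quadrupole alpha beta) = 0.
Proof.
rewrite /dipole (_ : \sum_(j < 4) _ = 0) ?scaler0 //.
rewrite !big_ord_recl big_ord0 /degree /quadrupole /=.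
by apply: injective_projections; rewrite /= /GRing.scale /=; ring.
Qed.

(** The dipole moment vanishes, and so do the interactions
    pdx F (0, 2 beta) and pdy F (2 alpha, 0), since F is even in each
    coordinate. *)
Lemma vortex_field_quadrupole (R : realType) (F : R * R -> R) (lambda alpha beta : R) :
  green_function F -> distinctT2 (quadrupole alpha beta) ->
  vortex_field F lambda (quadrupole alpha beta) ord0 = reduced_field F lambda alpha beta.
Proof.
move=> hF dq.
have px0 : pdx F (0, 2 * beta) = 0.
  have zL : ~ lattice ((0, 2 * beta) : R * R).
    have := dq ord0 (inord 3); rewrite /eqT2 /quadrupole /= inordK //= => H zL.
    apply: H; first by rewrite -val_eqE /= inordK.
    by rewrite (_ : _ - _ = (0, 2 * beta)) //; apply: injective_projections => /=; ring.
  have := grad_green_reflect2 hF (s := (-1, 1)) (z := (0, 2 * beta)).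
  rewrite /= sqrrN expr1n => /(_ erefl erefl zL) /(congr1 fst).
  by rewrite /reflect2 /= mulr0 mul1r; lra.
have py0 : pdy F (2 * alpha, 0) = 0.
  have zL : ~ lattice ((2 * alpha, 0) : R * R).
    have := dq ord0 (inord 2); rewrite /eqT2 /quadrupole /= inordK //= => H zL.
    apply: H; first by rewrite -val_eqE /= inordK.
    by rewrite (_ : _ - _ = (2 * alpha, 0)) //; apply: injective_projections => /=; ring.
  have := grad_green_reflect2 hF (s := (1, -1)) (z := (2 * alpha, 0)).
  rewrite /= sqrrN expr1n => /(_ erefl erefl zL) /(congr1 snd).
  by rewrite /reflect2 /= mulr0 mul1r; lra.
rewrite /vortex_field dipole_quadrupole subr0 /interaction.
have -> : \sum_(k < 4 | k != ord0)
    degree k *: grad F (quadrupole alpha beta ord0 - quadrupole alpha beta k) =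
   grad F (2 * alpha, 2 * beta) - grad F (2 * alpha, 0) - grad F (0, 2 * beta).
  rewrite big_mkcond !big_ord_recl big_ord0 /degree /quadrupole /= add0r addr0.
  have -> : (alpha, beta) - (- alpha, - beta) = (2 * alpha, 2 * beta).
    by apply: injective_projections => /=; ring.
  have -> : (alpha, beta) - (- alpha, beta) = (2 * alpha, 0).
    by apply: injective_projections => /=; ring.
  have -> : (alpha, beta) - (alpha, - beta) = (0, 2 * beta).
    by apply: injective_projections => /=; ring.
  by rewrite scale1r !scaleN1r addrA.
rewrite /mobility_solve /reduced_field /degree /= scale1r mulr1; congr (_ *: _).
apply: injective_projections; rewrite /= /GRing.scale /= px0 py0; ring.
Qed.

(** * Local Lipschitz continuity of the velocity field *)

Lemma lipschitz_of_derive (R : realType) (f df : R -> R) (c r L a b : R) :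
  (forall x, `|x - c| < r -> is_derive x 1 f (df x) /\ `|df x| <= L) ->
  `|a - c| < r -> `|b - c| < r -> `|f a - f b| <= L * `|a - b|.
Proof.
move=> H; wlog ab : a b / a <= b => [W ha hb|].
  have [ab|/ltW ba] := leP a b; first exact: W.
  by rewrite distrC [`|a - b|]distrC; exact: W.
move=> ha hb.
have inb x : x \in `[a, b]%R -> `|x - c| < r.
  rewrite in_itv /= => /andP[ax xb]; move: ha hb; rewrite !ltr_norml; lra.
have cf : {within `[a, b], continuous f}.
  by apply: derivable_within_continuous => x /inb /H[[]].
have [|x xab E] := @MVT_segment R f df a b ab _ cf.
  by move=> x xab; have [] := H x (inb x _) => //; move: xab; rewrite !in_itv /= => /andP[/ltW -> /ltW ->].
rewrite distrC E normrM [`|a - b|]distrC; apply: ler_wpM2r => //.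
by have [] := H x (inb x xab).
Qed.

Definition locally_lipschitz2 (R : realType) (G : R * R -> R) (z0 : R * R) :=
  exists r L : R, [/\ 0 < r, 0 <= L & forall z w : R * R,
    `|z.1 - z0.1| < r -> `|z.2 - z0.2| < r ->
    `|w.1 - z0.1| < r -> `|w.2 - z0.2| < r ->
    `|G z - G w| <= L * (`|z.1 - w.1| + `|z.2 - w.2|)].

(** Two points of a box are joined by a horizontal and a vertical segment; the
    mean value theorem is applied on each. *)
Lemma locally_lipschitz2_C1 (R : realType) (G : R * R -> R) (z0 : R * R) :
  (\forall z \near z0, derivable G z (1, 0) /\ derivable G z (0, 1)) ->
  {for z0, continuous (pdx G)} -> {for z0, continuous (pdy G)} ->
  locally_lipschitz2 G z0.
Proof.
move=> dG cx cy.
have above (x y : R) : 0 <= x -> 0 <= y ->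
    exists L : R, [/\ 0 <= L, x + 1 <= L & y + 1 <= L].
  by move=> x0 y0; exists (x + y + 1); split; lra.
have [L [L0 Lx Ly]] := above _ _ (normr_ge0 (pdx G z0)) (normr_ge0 (pdy G z0)).
have bnd H : {for z0, continuous H} -> `|H z0| + 1 <= L -> \forall z \near z0, `|H z| <= L.
  move=> cH hL; have cnH : {for z0, continuous (fun z => `|H z|)} by exact: cvg_norm.
  have : \forall z \near z0, `|H z| < `|H z0| + 1.
    by apply: (cnH [set u | u < `|H z0| + 1]); apply: lt_nbhsl; rewrite ltrDl.
  by apply: filterS => z zH; apply: le_trans hL; exact: ltW.
have /nbhs_ballP[r /= r0 hr] : \forall z \near z0,
    (derivable G z (1, 0) /\ derivable G z (0, 1)) /\ (`|pdx G z| <= L /\ `|pdy G z| <= L).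
  by apply: filterI => //; apply: filterI; [exact: bnd cx Lx|exact: bnd cy Ly].
exists r, L; split => // z w z1 z2 w1 w2.
have box (u : R * R) : `|u.1 - z0.1| < r -> `|u.2 - z0.2| < r ->
    [/\ derivable G u (1, 0), derivable G u (0, 1), `|pdx G u| <= L & `|pdy G u| <= L].
  move=> u1 u2.
  have ub : ball z0 r u by split; rewrite -ball_normE /ball_ /= distrC.
  by case: (hr u ub) => -[d1 d2] [l1 l2]; exact: And4 d1 d2 l1 l2.
have -> : G z - G w = (G (z.1, z.2) - G (w.1, z.2)) + (G (w.1, z.2) - G (w.1, w.2)).
  by rewrite addrA subrK -!surjective_pairing.
rewrite mulrDr; apply: le_trans (ler_normD _ _) _; apply: lerD.
  apply: (@lipschitz_of_derive _ (fun x => G (x, z.2)) (fun x => pdx G (x, z.2)) z0.1 r); [|exact: z1|exact: w1].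
  move=> x hx; have [dx _ dL _] := box (x, z.2) hx z2; split; last exact: dL.
  apply: (@is_derive_comp_affine R R (R * R)%type R G (fun x => (x, z.2)) x 1 (1, 0)).
    by move=> h; apply: injective_projections; rewrite /= /GRing.scale /= ?mulr0 ?add0r.
  exact/derivableP.
apply: (@lipschitz_of_derive _ (fun y => G (w.1, y)) (fun y => pdy G (w.1, y)) z0.2 r); [|exact: z2|exact: w2].
move=> y hy; have [_ dy _ dL] := box (w.1, y) w1 hy; split; last exact: dL.
apply: (@is_derive_comp_affine R R (R * R)%type R G (fun y => (w.1, y)) y 1 (0, 1)).
  by move=> h; apply: injective_projections; rewrite /= /GRing.scale /= ?mulr0 ?add0r.
exact/derivableP.
Qed.

Section config_lipschitz.
Variable R : realType.
Implicit Types (A B : 'I_4 -> R * R) (f g : ('I_4 -> R * R) -> R).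

Definition config_dist A B : R :=
  \sum_(k < 4) (`|(A k).1 - (B k).1| + `|(A k).2 - (B k).2|).

Definition config_close (r : R) A B :=
  forall k, `|(A k).1 - (B k).1| < r /\ `|(A k).2 - (B k).2| < r.

Definition locally_lipschitz f A0 := exists r L : R, [/\ 0 < r, 0 <= L &
  forall A B, config_close r A A0 -> config_close r B A0 ->
  `|f A - f B| <= L * config_dist A B].

Lemma config_dist_ge A B k :
  `|(A k).1 - (B k).1| + `|(A k).2 - (B k).2| <= config_dist A B.
Proof.
rewrite /config_dist (bigD1 k) //= lerDl; apply: sumr_ge0 => i _; exact: addr_ge0.
Qed.

Lemma locally_lipschitz_fst k A0 : locally_lipschitz (fun A => (A k).1) A0.
Proof.
exists 1, 1; split => // A B _ _; rewrite mul1r.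
by apply: le_trans (config_dist_ge A B k); rewrite lerDl.
Qed.

Lemma locally_lipschitz_snd k A0 : locally_lipschitz (fun A => (A k).2) A0.
Proof.
exists 1, 1; split => // A B _ _; rewrite mul1r.
by apply: le_trans (config_dist_ge A B k); rewrite lerDr.
Qed.

Lemma locally_lipschitzD f g A0 : locally_lipschitz f A0 -> locally_lipschitz g A0 ->
  locally_lipschitz (fun A => f A + g A) A0.
Proof.
move=> [r [L [r0 L0 Hf]]] [r' [L' [r0' L0' Hg]]].
exists (Num.min r r'), (L + L'); split; [by rewrite lt_min r0|exact: addr_ge0|].
move=> A B hA hB; rewrite opprD addrACA mulrDl.
apply: le_trans (ler_normD _ _) _; apply: lerD.
  by apply: Hf => k; [have := hA k|have := hB k]; rewrite !lt_min => -[/andP[? ?] /andP[? ?]].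
by apply: Hg => k; [have := hA k|have := hB k]; rewrite !lt_min => -[/andP[? ?] /andP[? ?]].
Qed.

Lemma locally_lipschitzZ f c A0 : locally_lipschitz f A0 ->
  locally_lipschitz (fun A => c * f A) A0.
Proof.
move=> [r [L [r0 L0 Hf]]]; exists r, (`|c| * L); split => //; first exact: mulr_ge0.
by move=> A B hA hB; rewrite -mulrBr normrM -mulrA ler_wpM2l // Hf.
Qed.

Lemma locally_lipschitz_sum (P : pred 'I_4) (f : 'I_4 -> ('I_4 -> R * R) -> R) A0 :
  (forall k, P k -> locally_lipschitz (f k) A0) ->
  locally_lipschitz (fun A => \sum_(k < 4 | P k) f k A) A0.
Proof.
move=> H; elim: (index_enum _) => [|k s IH].
  exists 1, 0; split => // A B _ _; by rewrite !big_nil subrr normr0 mul0r.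
have [Pk|Pk] := boolP (P k).
  have := locally_lipschitzD (H k Pk) IH; congr locally_lipschitz.
  by apply/funext => A; rewrite big_cons Pk.
move: IH; congr locally_lipschitz.
by apply/funext => A; rewrite big_cons (negbTE Pk).
Qed.

Lemma locally_lipschitz_pair G j k A0 : locally_lipschitz2 G (A0 j - A0 k) ->
  locally_lipschitz (fun A => G (A j - A k)) A0.
Proof.
move=> [r [L [r0 L0 HG]]]; exists (r / 2), (L * 2); split; [lra|lra|].
move=> A B hA hB.
have cl (u v u0 v0 : R) : `|u - u0| < r / 2 -> `|v - v0| < r / 2 -> `|u - v - (u0 - v0)| < r.
  move=> h1 h2; rewrite (_ : _ - _ = (u - u0) - (v - v0)); last by ring.
  apply: le_lt_trans (ler_normB _ _) _; lra.
have [a1 a2] := hA j; have [a3 a4] := hA k; have [b1 b2] := hB j; have [b3 b4] := hB k.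
have := HG (A j - A k) (B j - B k) (cl _ _ _ _ a1 a3) (cl _ _ _ _ a2 a4)
  (cl _ _ _ _ b1 b3) (cl _ _ _ _ b2 b4).
move=> /le_trans; apply.
rewrite -mulrA; apply: ler_wpM2l => //=.
have tri (u v u' v' : R) : `|u - v - (u' - v')| <= `|u - u'| + `|v - v'|.
  by rewrite (_ : _ - _ = (u - u') - (v - v')); [exact: ler_normB|ring].
have := tri (A j).1 (A k).1 (B j).1 (B k).1; have := tri (A j).2 (A k).2 (B j).2 (B k).2.
have := config_dist_ge A B j; have := config_dist_ge A B k; lra.
Qed.

End config_lipschitz.

Lemma locally_lipschitz_vortex_field (R : realType) (F : R * R -> R) (lambda : R)
    (A0 : 'I_4 -> R * R) (j : 'I_4) : green_function F -> distinctT2 A0 ->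
  locally_lipschitz (fun A => (vortex_field F lambda A j).1) A0 /\
  locally_lipschitz (fun A => (vortex_field F lambda A j).2) A0.
Proof.
move=> hF dA.
have [_ sF _ _ _] := hF; have [_ [_ _ Cx Cy]] := sF 2.
have C1 G : Ck 1 (~` lattice) G -> forall k, k != j -> locally_lipschitz2 G (A0 j - A0 k).
  move=> [_ [dx dy [cx _] [cy _]]] k kj.
  have zL : ~ lattice (A0 j - A0 k) by apply: dA; rewrite eq_sym.
  apply: locally_lipschitz2_C1; [|exact: cx|exact: cy].
  have := near_not_lattice zL; apply: filterS => z hz; split; [exact: dx|exact: dy].
pose w1 A := degree j * (\sum_(k < 4 | k != j) degree k * pdx F (A j - A k) +
  (- (2 * pi)) * \sum_(k < 4) degree k * (A k).1).
pose w2 A := degree j * (\sum_(k < 4 | k != j) degree k * pdy F (A j - A k) +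
  (- (2 * pi)) * \sum_(k < 4) degree k * (A k).2).
have l1 : locally_lipschitz w1 A0.
  apply/locally_lipschitzZ/locally_lipschitzD.
    apply: locally_lipschitz_sum => k kj; apply: locally_lipschitzZ.
    exact: (@locally_lipschitz_pair R (pdx F) j k A0 (C1 _ Cx k kj)).
  by apply/locally_lipschitzZ/locally_lipschitz_sum => k _; exact/locally_lipschitzZ/locally_lipschitz_fst.
have l2 : locally_lipschitz w2 A0.
  apply/locally_lipschitzZ/locally_lipschitzD.
    apply: locally_lipschitz_sum => k kj; apply: locally_lipschitzZ.
    exact: (@locally_lipschitz_pair R (pdy F) j k A0 (C1 _ Cy k kj)).
  by apply/locally_lipschitzZ/locally_lipschitz_sum => k _; exact/locally_lipschitzZ/locally_lipschitz_snd.
have wE A : degree j *: (interaction F A j - dipole A) = (w1 A, w2 A).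
  apply: injective_projections; rewrite /= /w1 /w2 /interaction /dipole /=.
    by rewrite !fst_sum mulNr.
  by rewrite !snd_sum mulNr.
pose c := 2 / (1 + lambda ^+ 2).
split.
  rewrite (_ : (fun A => _) = fun A => c * (w1 A + lambda * degree j * w2 A)).
    by apply/locally_lipschitzZ/locally_lipschitzD => //; exact: locally_lipschitzZ.
  by apply/funext => A; rewrite /vortex_field wE.
rewrite (_ : (fun A => _) = fun A => c * (w2 A + (- (lambda * degree j)) * w1 A)).
  by apply/locally_lipschitzZ/locally_lipschitzD => //; exact: locally_lipschitzZ.
by apply/funext => A; rewrite /vortex_field wE /mobility_solve /Jmul /= /GRing.scale /= mulrN mulNr.
Qed.

(** * Gronwall's inequality and continuation of zeros *)

(** The function e x * expR (- K x) is nonincreasing. *)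
Lemma gronwall_le0 (R : realType) (e e' : R -> R) (a b K : R) :
  {within `[a, b], continuous e} ->
  (forall x, x \in `]a, b[%R -> is_derive x 1 e (e' x) /\ e' x <= K * e x) ->
  e a = 0 -> forall x, x \in `[a, b]%R -> e x <= 0.
Proof.
move=> ce de ea x xab.
pose E : R -> R := fun y => expR (- K * y).
have dE (y : R) : is_derive y 1 E (- K * E y).
  have d1 : is_derive y 1 (fun z : R => - K * z) (- K).
    have := @is_deriveZ _ _ _ (@id R) (- K) y 1 1 (is_derive_id _ _).
    by rewrite [_ *: 1]mulr1.
  have := is_derive1_comp (is_derive_expR (- K * y)) d1.
  by rewrite mulrC.
pose h := e * E.
have dh (y : R) : y \in `]a, b[%R -> is_derive y 1 h (e y * (- K * E y) + E y * e' y).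
  by move=> /de[d1 _]; apply: is_deriveM.
have ch : {within `[a, b], continuous h}.
  move=> y; apply: cvgM; first exact: ce.
  have cE : continuous E.
    move=> z; apply: differentiable_continuous; apply/derivable1_diffP.
    by have [] := dE z.
  exact: (continuous_subspaceT cE).
have ha : h a = 0 by rewrite /h /= mulrfctE ea mul0r.
have ab : a <= b by move: xab; rewrite in_itv /= => /andP[ax xb]; exact: le_trans xb.
have : h x <= h a.
  apply: (@ler0_derive1_le_cc R h a b) => //.
  - by move=> y /dh[].
  - move=> y yab; have dy := dh y yab; rewrite derive1E derive_val.
    have [_ le] := de y yab.
    have : 0 < E y by exact: expR_gt0.
    nra.
  - by rewrite in_itv /= lexx ab.
  - by move: xab; rewrite in_itv /= => /andP[].
rewrite ha /h mulrfctE pmulr_lle0 //; exact: expR_gt0.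
Qed.

Lemma sqr_sum_le (R : realType) (I : finType) (x : I -> R) :
  (\sum_i x i) ^+ 2 <= #|I|%:R * \sum_i x i ^+ 2.
Proof.
have -> : #|I|%:R * \sum_i x i ^+ 2 = \sum_i \sum_j (x i ^+ 2 / 2 + x j ^+ 2 / 2).
  set T := \sum_i x i ^+ 2.
  rewrite (eq_bigr (fun i => #|I|%:R * (x i ^+ 2 / 2) + T / 2)) => [|i _].
    rewrite big_split /= sumr_const -mulr_sumr -mulr_suml -/T -[_ *+ #|_|]mulr_natl.
    by field.
  by rewrite big_split /= sumr_const -mulr_suml -[_ *+ #|_|]mulr_natl.
rewrite expr2 mulr_suml; apply: ler_sum => i _; rewrite mulr_sumr; apply: ler_sum => j _.
have := sqr_ge0 (x i - x j); lra.
Qed.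

Lemma is_derive_bigsum (R : realType) (I : finType) (f df : I -> R -> R) (x : R) :
  (forall i, is_derive x 1 (f i) (df i x)) ->
  is_derive x 1 (fun y => \sum_i f i y) (\sum_i df i x).
Proof.
move=> H; elim: (index_enum I) => [|i s IH].
  rewrite big_nil (_ : (fun y => _) = cst 0); first exact: is_derive_cst.
  by apply/funext => y; rewrite big_nil.
rewrite big_cons (_ : (fun y => _) = f i + (fun y => \sum_(k <- s) f k y)).
  exact: is_deriveD.
by apply/funext => y; rewrite big_cons.
Qed.

Lemma cvg_bigsum (R : realType) (T : Type) (I : finType) (G : set_system T) {FG : Filter G}
    (f : I -> T -> R) (l : I -> R) :
  (forall i, f i y @[y --> G] --> l i) ->
  (\sum_i f i y) @[y --> G] --> \sum_i l i.
Proof.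
move=> H; elim: (index_enum I) => [|i s IH].
  by rewrite big_nil; under eq_fun do rewrite big_nil; exact: cvg_cst.
rewrite big_cons; under eq_fun do rewrite big_cons.
exact: cvgD.
Qed.

(** The sum of the squares satisfies e' <= 2 L (sum |u_k|) ^ 2, which is at
    most 2 L #|I| e by the Cauchy-Schwarz inequality. *)
Lemma gronwall_family (R : realType) (I : finType) (u du : I -> R -> R) (a b L : R) :
  0 <= L ->
  (forall i, {within `[a, b], continuous (u i)}) ->
  (forall i x, x \in `]a, b[%R -> is_derive x 1 (u i) (du i x) /\
     `|du i x| <= L * \sum_k `|u k x|) ->
  (forall i, u i a = 0) -> forall x, x \in `[a, b]%R -> forall i, u i x = 0.
Proof.
move=> L0 cu hu ua x xab i.
pose e y := \sum_k u k y ^+ 2.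
have e0 : e x <= 0.
  apply: (@gronwall_le0 R e (fun y => \sum_k (u k y * du k y + u k y * du k y)) a b
           (2 * L * #|I|%:R)) => //; last first.
  - by rewrite /e big1 // => k _; rewrite ua expr0n.
  - move=> y yab; split.
      apply: (@is_derive_bigsum _ _ (fun k y => u k y ^+ 2) (fun k y => (u k y * du k y + u k y * du k y))) => k.
      have [dk _] := hu k y yab.
      by have := is_deriveM dk dk.
    set S := \sum_k `|u k y|.
    apply: (@le_trans _ _ (\sum_k 2 * L * S * `|u k y|)).
      apply: ler_sum => k _; have [_ hk] := hu k y yab.
      have := ler_wpM2l (normr_ge0 (u k y)) hk; rewrite -/S -normrM.
      have := ler_norm (u k y * du k y); lra.
    rewrite -mulr_sumr -/S -!mulrA -expr2; apply: ler_wpM2l => //; apply: ler_wpM2l => //.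
    rewrite expr2 -expr2; apply: le_trans (sqr_sum_le _) _.
    by apply: ler_wpM2l => //; apply: ler_sum => k _; rewrite -normrX ger0_norm ?sqr_ge0.
  - by move=> y; apply: cvg_bigsum => k; apply: cvgM; exact: cu.
have ek : u i x ^+ 2 <= e x.
  by rewrite /e (bigD1 i) //= lerDl; apply: sumr_ge0 => k _; exact: sqr_ge0.
by apply/eqP; rewrite -sqrf_eq0 eq_le sqr_ge0 (le_trans ek e0).
Qed.

(** Continuous induction: let m be the supremum of the times up to which all
    u_i vanish.  They vanish at m by continuity, and beyond m by hypothesis
    unless m = b. *)
Lemma zero_continuation (R : realType) (I : finType) (u : I -> R -> R) (b : R) :
  0 <= b -> (forall i, {within `[0, b], continuous (u i)}) ->
  (forall i, u i 0 = 0) ->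
  (forall t, 0 <= t < b -> (forall i, u i t = 0) ->
     exists2 d, 0 < d & forall s, t <= s <= t + d -> s <= b -> forall i, u i s = 0) ->
  forall i, u i b = 0.
Proof.
move=> b0 cu u0 ext.
pose S := [set t | 0 <= t <= b /\ forall s, 0 <= s <= t -> forall i, u i s = 0].
have S0 : S 0.
  by split; [rewrite lexx|move=> s /andP[s0 s1] i; rewrite (_ : s = 0) //; lra].
have Sub : ubound S b by move=> t [/andP[]].
have supS : has_sup S by split; [exists 0|exists b].
pose m := sup S.
have m0 : 0 <= m by exact: ub_le_sup supS.2 _ S0.
have mb : m <= b by apply: ge_sup; [exists 0|exact: Sub].
have lt_m (s : R) : 0 <= s < m -> forall i, u i s = 0.
  move=> /andP[s0 sm] i.
  have [t [_ tS] /ltW st] : exists2 t, S t & s < t by apply: sup_gt sm; exists 0.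
  by apply: tS; rewrite s0.
have um i : u i m = 0.
  have [m0'|mneq] := eqVneq m 0; first by rewrite m0' u0.
  have mpos : 0 < m by rewrite lt_neqAle eq_sym mneq.
  apply: contrapT => um.
  have min : `[0, b]%classic m by rewrite /= in_itv /= m0 mb.
  have /subspace_continuousP/(_ m min) := cu i.
  move=> /cvgrPdist_lt /(_ `|u i m|); rewrite normr_gt0 => /(_ (introN eqP um)).
  move=> /nbhs_ballP[r /= r0 hr].
  pose s := Num.max 0 (m - r / 2).
  have sm : s < m by rewrite gt_max mpos /= ltrBlDr ltrDl divr_gt0.
  have s0 : 0 <= s by rewrite le_max lexx.
  have : `|u i m - u i s| < `|u i m|.
    apply: (hr s); last by rewrite /= in_itv /= s0 (le_trans (ltW sm) mb).
    rewrite -ball_normE /ball_ /= gtr0_norm ?subr_gt0 //.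
    have : m - r / 2 <= s by rewrite le_max lexx orbT.
    lra.
  by rewrite (lt_m s) ?s0 // subr0 ltxx.
have le_m (s : R) : 0 <= s <= m -> forall i, u i s = 0.
  move=> /andP[s0]; rewrite le_eqVlt => /orP[/eqP -> //|sm]; apply: lt_m.
  by rewrite s0.
have [mb'|bm] := ltP m b; last by move=> i; rewrite (_ : b = m) //; apply/eqP; rewrite eq_le bm mb.
have [|d d0 hd] := ext m _ um; first by rewrite m0.
pose t := Num.min (m + d) b.
have tm : m < t by rewrite lt_min mb' ltrDl d0.
suff : t <= m by rewrite leNgt tm.
apply: ub_le_sup supS.2 _ _; split.
  by rewrite (le_trans m0 (ltW tm)) /= ge_min lexx orbT.
move=> s /andP[s0 st] i.
have [sm|ms] := leP s m; first by apply: le_m; rewrite s0.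
move: st; rewrite le_min => /andP[st sb].
by apply: hd => //; rewrite st ltW.
Qed.

Lemma at_right_interval (R : realType) (t : R) (P : set R) : (\forall s \near t^'+, P s) ->
  exists2 d, 0 < d & forall s, t < s < t + d -> P s.
Proof.
move=> /nbhs_ballP[d /= d0 hd]; exists d => // s /andP[ts sd].
by apply: hd => //; rewrite -ball_normE /ball_ /= distrC gtr0_norm ?subr_gt0 // ltrBlDl.
Qed.

(** The Lipschitz constant may depend on t and on i; only finitely many
    are in force at a given t, and their sum serves for all i. *)
Lemma ode_zero (R : realType) (I : finType) (u du : I -> R -> R) (b : R) :
  0 <= b -> (forall i, {within `[0, b], continuous (u i)}) ->
  (forall i t, t \in `]0, b[%R -> is_derive t 1 (u i) (du i t)) ->
  (forall i, u i 0 = 0) ->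
  (forall t, 0 <= t < b -> (forall i, u i t = 0) -> forall i,
     exists2 L, 0 <= L & \forall s \near t^'+, `|du i s| <= L * \sum_k `|u k s|) ->
  forall i, u i b = 0.
Proof.
move=> b0 cu du_ u0 hL; apply: zero_continuation => // t /andP[t0 tb] ut.
have [|L hL'] := choice (P := fun i L => 0 <= L /\
    \forall s \near t^'+, `|du i s| <= L * \sum_k `|u k s|).
  by move=> i; have [|L L0 HL] := hL t _ ut i; [rewrite t0|exists L].
have : \forall s \near t^'+, forall i, `|du i s| <= L i * \sum_k `|u k s|.
  by apply: filter_forall => i; have [] := hL' i.
move=> /at_right_interval[d d0 hd]; exists (d / 2); first by rewrite divr_gt0.
move=> s /andP[ts sd] sb.
pose LL := \sum_i L i.
have L0 i : 0 <= L i by have [] := hL' i.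
have LL0 : 0 <= LL by exact: sumr_ge0.
apply: (@gronwall_family R I u du t s LL LL0) => //; last by rewrite in_itv /= ts lexx.
  move=> i; apply: continuous_subspaceW (cu i).
  by move=> x /=; rewrite !in_itv /= => /andP[tx xs]; rewrite (le_trans t0 tx) (le_trans xs sb).
move=> i x; rewrite in_itv /= => /andP[tx xs]; split.
  by apply: du_; rewrite in_itv /= (le_lt_trans t0 tx) (lt_le_trans xs sb).
have xd : t < x < t + d by rewrite tx /=; lra.
apply: le_trans (hd x xd i) _; apply: ler_wpM2r; first exact: sumr_ge0.
by rewrite /LL (bigD1 i) //= lerDl sumr_ge0.
Qed.

(** * One-sided derivatives on the time interval *)

Definition deriv_in (R : realType) (I : set R) (u : R -> R) (t l : R) : Prop :=
  (s - t)^-1 * (u s - u t) @[s --> within I t^'] --> l.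

Lemma deriv_in_fst (R : realType) (I : set R) (f : R -> R * R) (t : R) v :
  derivative_on I f t v -> deriv_in I (fun s => (f s).1) t v.1.
Proof.
move=> H; rewrite /deriv_in.
have := @cvg_comp _ _ _ _ fst _ (nbhs v) (nbhs v.1) H; apply.
by rewrite [v]surjective_pairing; exact: cvg_fst.
Qed.

Lemma deriv_in_snd (R : realType) (I : set R) (f : R -> R * R) (t : R) v :
  derivative_on I f t v -> deriv_in I (fun s => (f s).2) t v.2.
Proof.
move=> H; rewrite /deriv_in.
have := @cvg_comp _ _ _ _ snd _ (nbhs v) (nbhs v.2) H; apply.
by rewrite [v]surjective_pairing; exact: cvg_snd.
Qed.

Lemma deriv_in_continuous (R : realType) (I : set R) (u : R -> R) (t l : R) :
  deriv_in I u t l -> u s @[s --> within I (nbhs t)] --> u t.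
Proof.
move=> H.
have c1 : (u t + (s - t) * ((s - t)^-1 * (u s - u t))) @[s --> within I t^'] --> u t + 0 * l.
  apply: cvgD; first exact: cvg_cst.
  apply: cvgM => //.
  have : (s - t) @[s --> nbhs t] --> t - t by apply: cvgB => //; exact: cvg_cst.
  rewrite subrr => h; apply: cvg_within_filter; exact: cvg_within_filter.
rewrite mul0r addr0 in c1.
have {}c1 : u s @[s --> within I t^'] --> u t.
  apply: cvg_trans c1; apply: near_eq_cvg.
  rewrite !near_withinE; near=> s => st _.
  by rewrite mulrA divff ?mul1r ?subr_eq0 // addrC subrK.
move=> V Vut.
have c1V : \forall s \near within I t^', V (u s) by exact: c1 V Vut.
suff : \forall s \near within I (nbhs t), V (u s) by [].
move: c1V; rewrite !near_withinE; apply: filterS => s h Is.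
have [->|st] := eqVneq s t; last exact: h.
exact: nbhs_singleton Vut.
Unshelve. all: by end_near. Qed.

Lemma deriv_in_is_derive (R : realType) (I : set R) (u : R -> R) (t l : R) :
  nbhs t I -> deriv_in I u t l -> is_derive t 1 u l.
Proof.
move=> nI H.
have q : h^-1 *: ((u \o shift t) (h *: 1) - u t) @[h --> (0 : R)^'] --> l.
  apply/cvgrPdist_lt => e e0.
  move/cvgrPdist_lt: H => /(_ e e0); rewrite !near_withinE => H.
  have /nbhs_ballP[r /= r0 hr] : \forall s \near t, I s /\
      (s != t -> I s -> `|l - (s - t)^-1 * (u s - u t)| < e) by exact: filterI.
  apply/nbhs_ballP; exists r => // h hb h0.
  have [] := hr (h + t).
    by move: hb; rewrite -!ball_normE /ball_ /= sub0r normrN opprD addrCA subrr addr0 normrN.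
  move=> Iht /(_ _ Iht) /=; rewrite addrK [h *: 1]mulr1; apply.
  by rewrite -subr_eq0 addrK.
split; first by apply/cvg_ex; exists l.
exact: cvg_lim q.
Qed.

(** By the intermediate value theorem f would otherwise take a value
    k + 1/2. *)
Lemma int_valued_constant (R : realType) (f : R -> R) (b : R) : 0 <= b ->
  {within `[0, b], continuous f} ->
  (forall t, 0 <= t <= b -> exists m : int, f t = m%:~R) -> f b = f 0.
Proof.
move=> b0 cf hf.
have [|m mE] := hf 0; first by rewrite lexx.
have [|n nE] := hf b; first by rewrite lexx b0.
apply: contrapT => ne.
have nm : n != m by apply/eqP => nm; apply: ne; rewrite mE nE nm.
pose k := Num.min m n.
have ivt : Num.min (f 0) (f b) <= k%:~R + 2^-1 <= Num.max (f 0) (f b).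
  rewrite mE nE ge_min le_max /k; case: (ltgtP m n) => [mn|mn|mn].
  - by have : (m + 1)%:~R <= n%:~R :> R; [rewrite ler_int; lia|rewrite intrD; lra].
  - by have : (n + 1)%:~R <= m%:~R :> R; [rewrite ler_int; lia|rewrite intrD; lra].
  - by move: nm; rewrite mn eqxx.
have [c cb fc] := IVT b0 cf ivt.
have [|l lE] := hf c; first by move: cb; rewrite in_itv.
have : (k < l)%R && (l < k + 1)%R.
  by rewrite -!(ltr_int R) intrD -lE fc; apply/andP; split; lra.
lia.
Qed.

(** * Symmetric initial data have symmetric solutions *)

Lemma time_interval_le (R : realType) (T : \bar R) (s t : R) :
  time_interval T t -> 0 <= s -> s <= t -> time_interval T s.
Proof.
by move=> [t0 tT] s0 st; split => //; apply: le_lt_trans tT; rewrite lee_fin.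
Qed.

Lemma time_interval_nbhs (R : realType) (T : \bar R) (t b : R) :
  time_interval T b -> t \in `]0, b[%R -> nbhs t (time_interval T).
Proof.
move=> bT; rewrite in_itv /= => /andP[t0 tb].
near=> s; apply: (time_interval_le bT).
  by apply: ltW; near: s; exact: lt_nbhsr.
by apply: ltW; near: s; exact: lt_nbhsl.
Unshelve. all: by end_near. Qed.

Lemma within_time_interval (R : realType) (T : \bar R) (u : R -> R) (b : R) :
  time_interval T b ->
  (forall t, time_interval T t -> u s @[s --> within (time_interval T) (nbhs t)] --> u t) ->
  {within `[0, b], continuous u}.
Proof.
move=> bT cu.
have : {within time_interval T, continuous u} by apply/subspace_continuousP.
apply: continuous_subspaceW => s /=; rewrite in_itv /= => /andP[s0 sb].
exact: time_interval_le sb.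
Qed.

Lemma near_right_time_interval (R : realType) (T : \bar R) (t b : R) (P : R -> Prop) :
  time_interval T b -> 0 <= t -> t < b ->
  (\forall x \near within (time_interval T) (nbhs t), P x) ->
  \forall x \near t^'+, P x.
Proof.
move=> bT t0 tb; rewrite near_withinE => h.
have h' : \forall x \near t^'+, time_interval T x -> P x.
  by rewrite near_withinE; apply: filterS h => x hx _.
near=> x.
have tx : t <= x by near: x; exact: nbhs_right_ge.
have xb : x <= b by near: x; exact: nbhs_right_le.
have : time_interval T x -> P x by near: x; exact: h'.
by apply; apply: (time_interval_le bT) => //; exact: le_trans tx.
Unshelve. all: by end_near. Qed.

Section mirror_invariance.
Variables (R : realType) (F : R * R -> R) (lambda : R) (T : \bar R).
Hypothesis hF : green_function F.
Variable A : R -> 'I_4 -> R * R.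
Hypothesis dA : forall t, time_interval T t -> distinctT2 (A t).
Hypothesis vA : forall t, time_interval T t -> forall j,
  derivative_on (time_interval T) (A^~ j) t (vortex_field F lambda (A t) j).

Lemma trajectory_cvg t j : time_interval T t ->
  (A s j).1 @[s --> within (time_interval T) (nbhs t)] --> (A t j).1 /\
  (A s j).2 @[s --> within (time_interval T) (nbhs t)] --> (A t j).2.
Proof.
move=> tT; split.
  exact: (deriv_in_continuous (deriv_in_fst (@vA t tT j))).
exact: (deriv_in_continuous (deriv_in_snd (@vA t tT j))).
Qed.

Variables (s : R * R) (p : 'I_4 -> 'I_4).
Hypotheses (s1 : s.1 ^+ 2 = 1) (s2 : s.2 = - s.1) (pK : involutive p)
  (dp : forall j, degree (p j) = - degree j :> R).

(** The mirror image of A solves the same system, by equivariance of the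
    field; [ode_zero] is applied to the coordinates of the difference,
    indexed by the vortex and a choice of coordinate. *)
Lemma mirror_invariant : (forall j, A 0 j = mirror s p (A 0) j) ->
  forall b, time_interval T b -> forall j, A b j = mirror s p (A b) j.
Proof.
move=> A0 b bT.
have b0 : 0 <= b by case: bT.
pose u (i : 'I_4 * bool) t := if i.2 then (A t i.1).1 - s.1 * (A t (p i.1)).1
                              else (A t i.1).2 - s.2 * (A t (p i.1)).2.
pose V t j := vortex_field F lambda (A t) j.
pose du (i : 'I_4 * bool) t := if i.2 then (V t i.1).1 - s.1 * (V t (p i.1)).1
                              else (V t i.1).2 - s.2 * (V t (p i.1)).2.
have sumE t : \sum_i `|u i t| = config_dist (A t) (mirror s p (A t)).
  rewrite /config_dist -(pair_bigA _ (fun j c => `|u (j, c) t|)) /=.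
  by apply: eq_bigr => j _; rewrite big_bool.
have uI t : (forall i, u i t = 0) -> A t = mirror s p (A t).
  move=> ut; apply/funext => j; apply: injective_projections; apply/eqP.
    by rewrite -subr_eq0; apply/eqP; exact: (ut (j, true)).
  by rewrite -subr_eq0; apply/eqP; exact: (ut (j, false)).
have cA := trajectory_cvg.
suff ub : forall i, u i b = 0 by move=> j; rewrite {1}(uI b ub).
apply: (@ode_zero R _ u du b b0).
- move=> [j c]; apply: (within_time_interval bT) => t tT.
  have [c1 c2] := cA t j tT; have [c3 c4] := cA t (p j) tT.
  by rewrite /u /=; case: c; apply: cvgB => //; apply: cvgM => //; exact: cvg_cst.
- move=> [j c] t tb.
  have nT := time_interval_nbhs bT tb.
  have tT := nbhs_singleton nT.
  have d1 := deriv_in_is_derive nT (deriv_in_fst (@vA t tT j)).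
  have d2 := deriv_in_is_derive nT (deriv_in_snd (@vA t tT j)).
  have d3 := deriv_in_is_derive nT (deriv_in_fst (@vA t tT (p j))).
  have d4 := deriv_in_is_derive nT (deriv_in_snd (@vA t tT (p j))).
  rewrite /u /du /=; case: c.
    exact: (is_deriveB d1 (is_deriveZ s.1 d3)).
  exact: (is_deriveB d2 (is_deriveZ s.2 d4)).
- move=> [j c]; have E := A0 j.
  by rewrite /u /= E /=; case: c; rewrite subrr.
move=> t /andP[t0 tb] ut [j c].
have tT : time_interval T t by apply: (time_interval_le bT) => //; exact: ltW.
have At := uI t ut.
have close r : 0 < r -> \forall x \near t^'+, config_close r (A x) (A t).
  move=> r0; apply: filter_forall => k; have [c1 c2] := cA t k tT.
  apply: (near_right_time_interval bT t0 tb).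
  move/cvgrPdist_lt: c1 => /(_ r r0) c1; move/cvgrPdist_lt: c2 => /(_ r r0) c2.
  near=> x; split; rewrite distrC; near: x; [exact: c1|exact: c2].
have inT : \forall x \near t^'+, time_interval T x.
  by apply: (near_right_time_interval bT t0 tb); rewrite near_withinE; near=> x.
have abs1 (v : R) : v ^+ 2 = 1 -> `|v| = 1.
  by move=> /sqr1_cases[] ->; rewrite ?normrN normr1.
have s2' : s.2 ^+ 2 = 1 by rewrite s2 sqrrN.
have mclose r x : config_close r (A x) (A t) -> config_close r (mirror s p (A x)) (A t).
  move=> h k; have [h1 h2] := h (p k).
  by rewrite At /mirror /= -!mulrBr !normrM (abs1 _ s1) (abs1 _ s2') !mul1r.
have VE x k : time_interval T x -> V x k = vortex_field F lambda (A x) k /\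
    reflect2 s (V x (p k)) = vortex_field F lambda (mirror s p (A x)) k.
  by move=> xT; split => //; rewrite vortex_field_mirror //; exact: dA.
have [Lip1 Lip2] := locally_lipschitz_vortex_field lambda j hF (dA tT).
case: c.
  have [r [L [r0 L0 HL]]] := Lip1; exists L => //.
  near=> x; have xT : time_interval T x by near: x.
  have cx : config_close r (A x) (A t) by near: x; exact: close.
  have [_ E] := VE x j xT.
  have := HL _ _ cx (mclose _ _ cx); rewrite sumE -E; exact.
have [r [L [r0 L0 HL]]] := Lip2; exists L => //.
near=> x; have xT : time_interval T x by near: x.
have cx : config_close r (A x) (A t) by near: x; exact: close.
have [_ E] := VE x j xT.
have := HL _ _ cx (mclose _ _ cx); rewrite sumE -E; exact.
Unshelve. all: by end_near. Qed.

End mirror_invariance.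

Lemma dipoleB (R : realType) (a b : 'I_4 -> R * R) :
  dipole (fun j => a j - b j) = dipole a - dipole b.
Proof.
rewrite /dipole -scalerBr -sumrB; congr (_ *: _).
by apply: eq_bigr => j _; rewrite scalerBr.
Qed.

Lemma latticeB (R : realType) (x y : R * R) : lattice x -> lattice y -> lattice (x - y).
Proof.
move=> [m [n ->]] [m' [n' ->]]; exists (m - m'), (n - n').
by apply: injective_projections; rewrite /= rmorphB.
Qed.

Lemma latticeD (R : realType) (x y : R * R) : lattice x -> lattice y -> lattice (x + y).
Proof.
move=> [m [n ->]] [m' [n' ->]]; exists (m + m'), (n + n').
by apply: injective_projections; rewrite /= rmorphD.
Qed.

(** The difference lies in 2 pi Z^2 and depends continuously on t. *)
Lemma momentum_constant (R : realType) (T : \bar R) (a : R -> 'I_4 -> R * R) (q : R -> R * R) :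
  (forall t, time_interval T t -> momentum_class (a t) (q t)) ->
  {within time_interval T, continuous q} ->
  (forall t, time_interval T t -> forall j,
     (a s j).1 @[s --> within (time_interval T) (nbhs t)] --> (a t j).1 /\
     (a s j).2 @[s --> within (time_interval T) (nbhs t)] --> (a t j).2) ->
  forall t, time_interval T t -> q t - dipole (a t) = q 0 - dipole (a 0).
Proof.
move=> hm /subspace_continuousP cq ca b bT.
have b0 : 0 <= b by case: bT.
have p0 : 2 * pi != 0 :> R by rewrite mulf_neq0 // gt_eqF // pi_gt0.
have inT t : 0 <= t <= b -> time_interval T t.
  by move=> /andP[t0 tb]; exact: time_interval_le bT t0 tb.
pose f1 t := (2 * pi)^-1 * ((q t).1 - 2 * pi * \sum_(j < 4) degree j * (a t j).1).
pose f2 t := (2 * pi)^-1 * ((q t).2 - 2 * pi * \sum_(j < 4) degree j * (a t j).2).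
have d1 t : (dipole (a t)).1 = 2 * pi * \sum_(j < 4) degree j * (a t j).1.
  by rewrite /dipole /= fst_sum.
have d2 t : (dipole (a t)).2 = 2 * pi * \sum_(j < 4) degree j * (a t j).2.
  by rewrite /dipole /= snd_sum.
have c1 : {within `[0, b], continuous f1}.
  apply: (within_time_interval bT) => t tT.
  apply: cvgM; first exact: cvg_cst.
  apply: cvgB; last first.
    apply: cvgM; first exact: cvg_cst.
    apply: cvg_bigsum => j; apply: cvgM; [exact: cvg_cst|exact: (ca t tT j).1].
  have := @cvg_comp _ _ _ _ fst _ (nbhs (q t)) (nbhs (q t).1) (cq t tT); apply.
  by rewrite [q t]surjective_pairing; exact: cvg_fst.
have c2 : {within `[0, b], continuous f2}.
  apply: (within_time_interval bT) => t tT.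
  apply: cvgM; first exact: cvg_cst.
  apply: cvgB; last first.
    apply: cvgM; first exact: cvg_cst.
    apply: cvg_bigsum => j; apply: cvgM; [exact: cvg_cst|exact: (ca t tT j).2].
  have := @cvg_comp _ _ _ _ snd _ (nbhs (q t)) (nbhs (q t).2) (cq t tT); apply.
  by rewrite [q t]surjective_pairing; exact: cvg_snd.
have i1 t : 0 <= t <= b -> exists m : int, f1 t = m%:~R.
  move=> /inT /hm[k [m [n kE]] qE]; exists m.
  rewrite /f1 -d1 qE kE; move: (dipole (a t)) => D.
  by rewrite /= addrAC subrr add0r /GRing.scale /= mulKf.
have i2 t : 0 <= t <= b -> exists m : int, f2 t = m%:~R.
  move=> /inT /hm[k [m [n kE]] qE]; exists n.
  rewrite /f2 -d2 qE kE; move: (dipole (a t)) => D.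
  by rewrite /= addrAC subrr add0r /GRing.scale /= mulKf.
have p0' : (2 * pi)^-1 != 0 :> R by rewrite invr_eq0.
apply: injective_projections; apply: (mulfI p0').
  rewrite -[(q b - _).1]/((q b).1 - (dipole (a b)).1) -[(q 0 - _).1]/((q 0).1 - (dipole (a 0)).1) !d1.
  exact: int_valued_constant b0 c1 i1.
rewrite -[(q b - _).2]/((q b).2 - (dipole (a b)).2) -[(q 0 - _).2]/((q 0).2 - (dipole (a 0)).2) !d2.
exact: int_valued_constant b0 c2 i2.
Qed.

Theorem lemma5p3 (R : realType) (F : R * R -> R) (hF : green_function F)
    (lambda : R) (T : \bar R) (hT : (0 < T)%E)
    (alpha0 beta0 : R) (a0 : 'I_4 -> R * R) (q0 : R * R)
    (a : R -> 'I_4 -> R * R) (q : R -> R * R)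
    (ha0 : distinctT2 a0)
    (hsym : forall j, eqT2 (a0 j) (symmetric_configuration alpha0 beta0 j))
    (hq0 : q0 = 0)
    (hsol : vortex_solution F lambda T a0 q0 a q) :
  exists alpha beta : R -> R,
    forall t, time_interval T t ->
      (forall j, eqT2 (a t j) (symmetric_configuration (alpha t) (beta t) j)) /\
      derivative_on (time_interval T) (fun s => (alpha s, beta s)) t
        (reduced_field F lambda (alpha t) (beta t)).
Proof.
have [a0E q0E cq sol] := hsol.
pose Q := quadrupole alpha0 beta0.
(* Subtracting a 0 j - Q j, which is (1/2, 1/2) plus a lattice vector, recentres
   the configuration and fixes the lift so that A 0 = Q exactly. *)
pose A t j := a t j - (a 0 j - Q j).
have T0 : time_interval T 0 by split.
have pi0 : pi != 0 :> R by rewrite gt_eqF // pi_gt0.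
have offL j : lattice (a 0 j - Q j - (2^-1, 2^-1)).
  rewrite -addrA -opprD [Q j + _]addrC -(subrK (a0 j) (a 0 j)) -addrA.
  by apply: latticeD; [exact: a0E|exact: hsym].
have AB t j k : eqT2 (A t j - A t k) (a t j - a t k).
  rewrite /eqT2 (_ : _ - _ = (a 0 k - Q k - (2^-1, 2^-1)) - (a 0 j - Q j - (2^-1, 2^-1))).
    exact: latticeB.
  by rewrite /A; apply: injective_projections => /=; ring.
have dA t : time_interval T t -> distinctT2 (A t).
  move=> tT j k jk; have [da _ _] := sol t tT; have := da j k jk; apply: contra_not.
  move=> AL; rewrite /eqT2 -[a t j - a t k](subKr (A t j - A t k)).
  exact: latticeB AL (AB t j k).
have ca t j : time_interval T t ->
    (a s j).1 @[s --> within (time_interval T) (nbhs t)] --> (a t j).1 /\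
    (a s j).2 @[s --> within (time_interval T) (nbhs t)] --> (a t j).2.
  move=> tT; have [_ _ /(_ j)[v hv _]] := sol t tT.
  split; [exact: (deriv_in_continuous (deriv_in_fst hv))|exact: (deriv_in_continuous (deriv_in_snd hv))].
have qE t : time_interval T t -> q t = dipole (A t).
  move=> tT; have hm s : time_interval T s -> momentum_class (a s) (q s).
    by move=> sT; have [] := sol s sT.
  have := momentum_constant hm cq (fun t tT j => ca t j tT) tT.
  rewrite q0E hq0 sub0r => /eqP; rewrite subr_eq => /eqP ->.
  rewrite /A dipoleB (dipoleB (a 0)) dipole_quadrupole subr0.
  by rewrite addrC.
have vA t : time_interval T t -> forall j,
    derivative_on (time_interval T) (A^~ j) t (vortex_field F lambda (A t) j).
  move=> tT j; have [da _ /(_ j)[v hv vE]] := sol t tT.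
  have -> : vortex_field F lambda (A t) j = v.
    apply/esym/mobility_solveP; first exact: degree_sqr.
    rewrite vE (grad_energyE hF) // qE // (interaction_eq hF (AB t j)).
    rewrite !scalerA -[in RHS]opprB scalerN -scaleNr; congr (_ *: _).
    by rewrite [2 * pi]mulrC -mulrA mulNr mulKf.
  rewrite /derivative_on (_ : (fun s => _) = (fun s => (s - t)^-1 *: (a s j - a t j))) //.
  apply/funext => s; rewrite /A; move: (a 0 j - Q j) => k.
  by rewrite opprB addrA subrK.
have A0 : A 0 = Q by apply/funext => j; rewrite /A subKr.
have ord4 (P : 'I_4 -> Prop) : P (inord 0) -> P (inord 1) -> P (inord 2) -> P (inord 3) ->
    forall j, P j.
  move=> P0 P1 P2 P3 j; rewrite -(inord_val j).
  by case: j => -[|[|[|[|]]]].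
(* The reflection x |-> - x exchanges vortices 1, 3 and 2, 4; the reflection
   y |-> - y exchanges 1, 4 and 2, 3. *)
pose p1 (j : 'I_4) : 'I_4 := inord ((j + 2) %% 4).
pose p2 (j : 'I_4) : 'I_4 := inord (3 - j).
have p1K : involutive p1.
  by apply: ord4; apply/val_inj; rewrite /p1 /= !inordK //= !inordK.
have p2K : involutive p2.
  by apply: ord4; apply/val_inj; rewrite /p2 /= !inordK //= !inordK.
have dp1 j : degree (p1 j) = - degree j :> R.
  by move: j; apply: ord4; rewrite /degree /p1 !inordK //= ?opprK // !inordK.
have dp2 j : degree (p2 j) = - degree j :> R.
  by move: j; apply: ord4; rewrite /degree /p2 !inordK //= ?opprK // !inordK.
have m1 t : time_interval T t -> forall j, A t j = mirror (-1, 1) p1 (A t) j.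
  apply: (mirror_invariant hF dA vA _ _ p1K dp1) => /=; rewrite ?opprK ?sqrrN ?expr1n //.
  by rewrite A0; apply: ord4; rewrite /mirror /reflect2 /Q /quadrupole /p1 !inordK //= ?inordK //=;
    rewrite ?mulN1r ?mul1r ?opprK.
have m2 t : time_interval T t -> forall j, A t j = mirror (1, -1) p2 (A t) j.
  apply: (mirror_invariant hF dA vA _ _ p2K dp2) => /=; rewrite ?opprK ?sqrrN ?expr1n //.
  by rewrite A0; apply: ord4; rewrite /mirror /reflect2 /Q /quadrupole /p2 !inordK //= ?inordK //=;
    rewrite ?mulN1r ?mul1r ?opprK.
have hA t j : lattice (a t j - ((2^-1, 2^-1) + A t j)).
  rewrite (_ : _ - _ = a 0 j - Q j - (2^-1, 2^-1)); first exact: offL.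
  by rewrite /A; apply: injective_projections => /=; ring.
clearbody A.
exists (fun t => (A t ord0).1), (fun t => (A t ord0).2) => t tT.
have AE : A t = quadrupole (A t ord0).1 (A t ord0).2.
  have A3 : A t (inord 3) = ((A t ord0).1, - (A t ord0).2).
    rewrite (m2 t tT) /mirror /p2 inordK //= /reflect2 /= mulN1r mul1r.
    by rewrite (_ : inord 0 = ord0) //; apply/val_inj; rewrite /= inordK.
  have A2 : A t (inord 2) = (- (A t ord0).1, (A t ord0).2).
    rewrite (m1 t tT) /mirror /p1 inordK //= /reflect2 /= mulN1r mul1r.
    by rewrite (_ : inord 0 = ord0) //; apply/val_inj; rewrite /= inordK.
  have A1 : A t (inord 1) = (- (A t ord0).1, - (A t ord0).2).
    rewrite (m2 t tT) /mirror /p2 inordK //= /reflect2 /= mulN1r mul1r.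
    by rewrite (_ : (3 - 1)%N = 2%N) // A2.
  apply/funext; apply: ord4; rewrite ?A1 ?A2 ?A3 /quadrupole inordK //=.
  by rewrite -surjective_pairing; congr (A t _); apply/val_inj; rewrite /= inordK.
split.
  move=> j; rewrite /eqT2 (_ : symmetric_configuration _ _ j = (2^-1, 2^-1) + A t j); last by rewrite AE.
  exact: hA.
have := vA t tT ord0.
rewrite AE vortex_field_quadrupole //; last by rewrite -AE; exact: dA.
Qed.
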